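(* Let $d\in\mathbb{N}$, let $V:\mathbb{Z}^d\to\mathbb{R}$, and let $H_V=-\Delta+V$ be the discrete Schrödinger operator on $\ell^2(\mathbb{Z}^d)$. If there exists $s\in\mathbb{N}_0$ such that $$V_n\leq -2d+\sum_{j=1}^{d}\left[\left(\frac{|n|}{|n+\delta_j|}\right)^{d/2}\prod_{i=1}^{s}\sqrt{\frac{\log_i|n|}{\log_i|n+\delta_j|}}+\left(\frac{|n|}{|n-\delta_j|}\right)^{d/2}\prod_{i=1}^{s}\sqrt{\frac{\log_i|n|}{\log_i|n-\delta_j|}}\right]$$ for all $n\in\mathbb{Z}^d$ with $|n|$ sufficiently large, then $H_V$ does not have a zero energy ground state, i.e. $0\notin\sigma_{\mathrm{p}}(H_V)$ or $0\neq\inf\sigma(H_V)$. In particular, this is the case if, for some $s\in\mathbb{N}_0$, $$V_n\leq \frac{d(4-d)}{4|n|^2}+\frac{1}{|n|^2}\sum_{j=1}^{s}\prod_{k=1}^{j}\frac{1}{\log_k|n|}$$ for all $n\in\mathbb{Z}^d$ with $|n|$ sufficiently large.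
   Context: The discrete Laplacian is $(-\Delta\psi)_n:=\sum_{m\in\mathbb{Z}^d,\,|m-n|=1}(\psi_n-\psi_m)$ for $\psi:\mathbb{Z}^d\to\mathbb{C}$, $n\in\mathbb{Z}^d$, where $|\cdot|$ is the Euclidean norm; it is a bounded self-adjoint operator on $\ell^2(\mathbb{Z}^d)$. A potential $V:\mathbb{Z}^d\to\mathbb{R}$ is identified with the multiplication operator $(V\psi)_n=V_n\psi_n$ on its maximal domain $\{\psi\in\ell^2(\mathbb{Z}^d): V\psi\in\ell^2(\mathbb{Z}^d)\}$, and $H_V:=-\Delta+V$ is self-adjoint on this domain. $\sigma(H)$ and $\sigma_{\mathrm{p}}(H)$ denote the spectrum and the point spectrum (set of eigenvalues). $\delta_j$ is the $j$-th standard basis vector of $\mathbb{Z}^d$. Iterated logarithms: $\log_0x:=x$ and $\log_{k}x:=\log(\log_{k-1}x)$ for $k\in\mathbb{N}$ ($x$ large enough). Empty sums equal $0$ and empty products equal $1$. $\mathbb{N}=\{1,2,\dots\}$, $\mathbb{N}_0=\mathbb{N}\cup\{0\}$. *)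

(* Defs.v *)
From HB Require Import structures.
From mathcomp Require Import all_boot all_order all_algebra.
From mathcomp Require Import complex.
From mathcomp Require Import all_classical all_reals all_analysis.

Set Implicit Arguments.
Unset Strict Implicit.
Unset Printing Implicit Defensive.

Import Order.TTheory GRing.Theory Num.Theory.
Import numFieldNormedType.Exports.

Local Open Scope classical_set_scope.
Local Open Scope ring_scope.

Section Lattice.
Variables (R : realType) (d : nat).

Definition enorm (n : 'rV[int]_d) : R :=
  Num.sqrt (\sum_(j < d) (n ord0 j)%:~R ^+ 2).

Definition delta (j : 'I_d) : 'rV[int]_d := delta_mx ord0 j.

Definition cmod (z : R[i]) : R := ComplexField.Normc.normc z.

Definition l2sqnorm (psi : 'rV[int]_d -> R[i]) : \bar R :=
  \esum_(n in [set: 'rV[int]_d]) (cmod (psi n) ^+ 2)%:E.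

Definition l2 : set ('rV[int]_d -> R[i]) :=
  [set psi | (l2sqnorm psi < +oo)%E].

Definition l2norm (psi : 'rV[int]_d -> R[i]) : R :=
  Num.sqrt (fine (l2sqnorm psi)).

(* A finitely supported sum (it would be 0 on an infinite support): the index
   set is finite, being the set of the 2d nearest neighbours of n. *)
Definition neg_laplacian (psi : 'rV[int]_d -> R[i]) : 'rV[int]_d -> R[i] :=
  fun n => \sum_(m \in [set m | enorm (m - n) = 1]) (psi n - psi m).

Definition mulop (V : 'rV[int]_d -> R) (psi : 'rV[int]_d -> R[i]) :
  'rV[int]_d -> R[i] := fun n => (V n)%:C%C * psi n.

Definition schrodinger (V : 'rV[int]_d -> R) (psi : 'rV[int]_d -> R[i]) :
  'rV[int]_d -> R[i] := fun n => neg_laplacian psi n + mulop V psi n.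

(* Since neg_laplacian is bounded on l2, this is also the domain of
   [schrodinger V]. *)
Definition mulop_dom (V : 'rV[int]_d -> R) : set ('rV[int]_d -> R[i]) :=
  [set psi | l2 psi /\ l2 (mulop V psi)].

(* In what follows an unbounded operator on l2 is a pair of a domain [D],
   included in l2, and a map [H], of which only the values on [D] matter. *)
Definition shifted (H : ('rV[int]_d -> R[i]) -> ('rV[int]_d -> R[i]))
    (z : R[i]) (psi : 'rV[int]_d -> R[i]) : 'rV[int]_d -> R[i] :=
  fun n => H psi n - z * psi n.

(* H - z : D -> l2 is a bijection with bounded inverse. *)
Definition resolvent_set (D : set ('rV[int]_d -> R[i]))
    (H : ('rV[int]_d -> R[i]) -> ('rV[int]_d -> R[i])) : set R[i] :=
  [set z | set_bij D l2 (shifted H z) /\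
    exists c : R, forall psi, D psi ->
      l2norm psi <= c * l2norm (shifted H z psi)].

Definition spectrum (D : set ('rV[int]_d -> R[i]))
    (H : ('rV[int]_d -> R[i]) -> ('rV[int]_d -> R[i])) : set R[i] :=
  ~` resolvent_set D H.

Definition point_spectrum (D : set ('rV[int]_d -> R[i]))
    (H : ('rV[int]_d -> R[i]) -> ('rV[int]_d -> R[i])) : set R[i] :=
  [set z | exists psi, [/\ D psi, psi <> (fun=> 0) &
    H psi = (fun n => z * psi n)]].

(* The spectrum of a self-adjoint operator is real, so restricting to real
   points loses nothing. The infimum is taken in the extended reals because
   the operator need not be bounded from below. *)
Definition inf_spectrum (D : set ('rV[int]_d -> R[i]))
    (H : ('rV[int]_d -> R[i]) -> ('rV[int]_d -> R[i])) : \bar R :=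
  ereal_inf [set x%:E | x in [set x : R | spectrum D H x%:C%C]].

Definition no_zero_energy_ground_state (V : 'rV[int]_d -> R) : Prop :=
  ~ point_spectrum (mulop_dom V) (schrodinger V) 0 \/
  inf_spectrum (mulop_dom V) (schrodinger V) <> 0%E.

Definition for_large_norm (P : 'rV[int]_d -> Prop) : Prop :=
  exists r : R, forall n, r <= enorm n -> P n.

End Lattice.

(* [ln] is total with ln x = 0 for x <= 0; iterated logarithms are only used
   at arguments large enough for every logarithm involved to be positive. *)
Definition iterlog (R : realType) (k : nat) (x : R) : R := iter k (@ln R) x.

(* Main.v *)
Require Import Defs.
From HB Require Import structures.
From mathcomp Require Import all_boot all_order all_algebra.
From mathcomp Require Import complex.
From mathcomp Require Import all_classical all_reals all_analysis.
From mathcomp Require Import ring lra zify.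

Set Implicit Arguments.
Unset Strict Implicit.
Unset Printing Implicit Defensive.

Import Order.TTheory GRing.Theory Num.Theory.
Import numFieldNormedType.Exports.

Local Open Scope classical_set_scope.
Local Open Scope ring_scope.

(* If zero were a ground state energy, the form of H_V would be nonnegative:
otherwise the infimum of the numerical range of the bounded self-adjoint
operator (H_V - x)^-1, x < 0, would be negative and an approximate eigenvalue,
giving negative spectrum. The modulus of a real eigenfunction then minimises
the form, so it is again an eigenfunction, and by connectedness of the lattice
it is a strictly positive phi in l2. The function u(n) = |n|^(-d/2) (log_1 |n|
... log_s |n|)^(-1/2) is, near infinity, a subsolution for V. Since the edge
weight u(n) u(m) is recurrent, testing the equation for phi/u with the
truncation (c - phi/u)_+ times a cutoff gives phi >= c u for some c > 0; but u
is not square summable.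

For the explicit criterion write u(n) = F(|n|^2) with F built from s + 1
logarithms. F is completely monotone, because nonnegative polynomials in 1/t
and the 1/log_k (sqrt t) are preserved by minus differentiation. The fourth
derivative of F being nonnegative, F(t+1+h) + F(t+1-h) >= 2 F(t+1) + h^2
F''(t+1) without error term, and the additional logarithm absorbs the remaining
correction of order t^-2. *)

(** * Absolutely convergent sums *)

(** The hypothesis on the spectrum enters only as bounded invertibility of [H_V - x] for real
    [x < 0]; no lower bound on the form of the unbounded [H_V] is known beforehand. The variational
    argument is therefore made for [B = (H_V - x)^-1], whose numerical range is bounded, and the
    resolvent at points below [x] gives the lower bounds on [B + m] that contradict a negative
    infimum [- m]. The inequality for [V] is assumed only far out, while [phi] has to dominate [c u]
    everywhere. With [c] a positive lower bound of [phi / u] on a large box, [(c - phi/u)_+]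
    vanishes wherever nothing is known about [V]. The decay [u^2 |n|^d <= 1] makes the weight cancel
    the volume, so a linear cutoff at scale [N] has energy of order [N^-2] in every dimension. In
    the variable [t = |n|^2] the two neighbours of [n] in direction [j] lie symmetrically about
    [t + 1], which is why the second-order expansion is taken there and not at [t]. *)

Section AbsoluteSums.
Variables (R : realType) (T : choiceType).
Implicit Types f g h : T -> R.

Definition asum f : Prop := (\esum_(x in [set: T]) (`|f x|)%:E < +oo)%E.

Definition nnsum f : R := fine (\esum_(x in [set: T]) (f x)%:E)%E.

Definition Sum f : R :=
  nnsum (fun x => Num.max (f x) 0) - nnsum (fun x => Num.max (- f x) 0).

Lemma asumE f : asum f <-> (\esum_(x in [set: T]) (`|f x|)%:E < +oo)%E.
Proof. by []. Qed.

Lemma asum_le g f : asum g -> (forall x, `|f x| <= `|g x|) -> asum f.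
Proof.
by move=> sg fg; apply: le_lt_trans sg; apply: le_esum => x _; rewrite lee_fin.
Qed.

Lemma asum_dom g f : asum g -> (forall x, `|f x| <= g x) -> asum f.
Proof.
by move=> sg fg; apply: asum_le sg _ => x; rewrite (le_trans (fg x)) ?ler_norm.
Qed.

Lemma asumD f g : asum f -> asum g -> asum (fun x => f x + g x).
Proof.
move=> sf sg.
have : (\esum_(x in [set: T]) ((`|f x|)%:E + (`|g x|)%:E) < +oo)%E.
  by rewrite esumD ?lte_add_pinfty // => x _; rewrite lee_fin.
apply: le_lt_trans; apply: le_esum => x _.
by rewrite -EFinD lee_fin ler_normD.
Qed.

Lemma asum_fin f : asum f -> (forall x, 0 <= f x) ->
  (\esum_(x in [set: T]) (f x)%:E)%E \is a fin_num.
Proof.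
move=> sf f0; rewrite ge0_fin_numE; last first.
  by apply: esum_ge0 => x _; rewrite lee_fin.
by move: sf; rewrite /asum; under eq_esum do rewrite ger0_norm//.
Qed.

Lemma nnsumD f g : asum f -> asum g ->
  (forall x, 0 <= f x) -> (forall x, 0 <= g x) ->
  nnsum (fun x => f x + g x) = nnsum f + nnsum g.
Proof.
move=> sf sg f0 g0; rewrite /nnsum.
under eq_esum do rewrite EFinD.
by rewrite esumD ?fineD ?asum_fin // => x _; rewrite lee_fin.
Qed.

Lemma nnsum_ge0 f : (forall x, 0 <= f x) -> 0 <= nnsum f.
Proof. by move=> f0; apply/fine_ge0/esum_ge0 => x _; rewrite lee_fin. Qed.

Lemma asum_pos f : asum f -> asum (fun x => Num.max (f x) 0).
Proof.
move=> sf; apply: asum_le sf _ => x; move: (f x) => y.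
by rewrite ger0_norm ?le_max ?lexx ?orbT // ge_max ler_norm normr_ge0.
Qed.

Lemma asumN f : asum f -> asum (fun x => - f x).
Proof. by move=> sf; apply: asum_le sf _ => x; rewrite normrN. Qed.

Lemma asumB f g : asum f -> asum g -> asum (fun x => f x - g x).
Proof. by move=> sf sg; apply: asumD => //; apply: asumN. Qed.

Lemma max0_ge0 (y : R) : 0 <= Num.max y 0.
Proof. by rewrite le_max lexx orbT. Qed.

Lemma max0_sub (y : R) : Num.max y 0 - Num.max (- y) 0 = y.
Proof. by case: (leP y 0) => y0; case: (leP (- y) 0) => y1; lra. Qed.

(** Pointwise [f^+ + h = f^- + g], and additivity of [nnsum] transfers this to the sums. Linearity
    of [Sum] follows by exhibiting suitable [g] and [h]. *)
Lemma Sum_split f g h : asum g -> asum h ->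
  (forall x, 0 <= g x) -> (forall x, 0 <= h x) ->
  (forall x, f x = g x - h x) -> Sum f = nnsum g - nnsum h.
Proof.
move=> sg sh g0 h0 fE.
have sf : asum f by apply: asum_le (asumB sg sh) _ => x; rewrite fE.
have : nnsum (fun x => Num.max (f x) 0 + h x) =
       nnsum (fun x => Num.max (- f x) 0 + g x).
  congr nnsum; apply/funext => x.
  by have := max0_sub (f x); have := fE x; lra.
rewrite !nnsumD // /Sum; first by lra.
all: try by move=> x; exact: max0_ge0.
all: by apply: asum_pos => //; apply: asumN.
Qed.

Lemma Sum_ge0E f : asum f -> (forall x, 0 <= f x) -> Sum f = nnsum f.
Proof.
move=> sf f0; rewrite (@Sum_split f f (fun=> 0)) //; last 2 first.
- by apply: asum_le sf _ => x; rewrite normr0.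
- by move=> x; rewrite subr0.
by rewrite [X in _ - X]/nnsum esum1 ?subr0.
Qed.

Lemma SumD f g : asum f -> asum g -> Sum (fun x => f x + g x) = Sum f + Sum g.
Proof.
move=> sf sg; have sf' := asumN sf; have sg' := asumN sg.
rewrite (@Sum_split _ (fun x => Num.max (f x) 0 + Num.max (g x) 0)
  (fun x => Num.max (- f x) 0 + Num.max (- g x) 0)); last first.
- by move=> x; have := max0_sub (f x); have := max0_sub (g x); lra.
- by move=> x; rewrite addr_ge0 ?max0_ge0.
- by move=> x; rewrite addr_ge0 ?max0_ge0.
- by apply: asumD; apply: asum_pos.
- by apply: asumD; apply: asum_pos.
rewrite !nnsumD /Sum; first by lra.
all: try by move=> x; exact: max0_ge0.
all: exact: asum_pos.
Qed.

Lemma SumN f : Sum (fun x => - f x) = - Sum f.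
Proof.
rewrite /Sum opprB; congr (_ - nnsum _).
by apply/funext => x; rewrite opprK.
Qed.

Lemma asumZ c f : asum f -> asum (fun x => c * f x).
Proof.
move=> sf.
have natZ n : asum (fun x => n%:R * f x).
  elim: n => [|n IH]; first by apply: asum_le sf _ => x; rewrite mul0r normr0.
  by apply: asum_le (asumD sf IH) _ => x; rewrite mulrSr mulrDl mul1r addrC.
have [n cn] : exists n : nat, `|c| <= n%:R.
  by exists (Num.trunc `|c|).+1; rewrite ltW // truncnS_gt.
apply: asum_le (natZ n) _ => x.
by rewrite !normrM ler_wpM2r // normr_nat.
Qed.

Lemma nnsumZ c f : (forall x, 0 <= f x) -> 0 <= c -> asum f ->
  nnsum (fun x => c * f x) = c * nnsum f.
Proof.
move=> f0 c0 sf; rewrite /nnsum -[c in RHS]/(fine c%:E) -fineM ?asum_fin //.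
congr fine; rewrite /esum -ereal_supZl //; last first.
  by apply/set0P; exists 0%E; exists set0; [exact: fsets_set0|rewrite fsbig_set0].
rewrite image_comp; congr ereal_sup; apply: eq_imagel => A [finA _] /=.
by rewrite ge0_mule_fsumr // => x; rewrite lee_fin.
Qed.

Lemma SumZ c f : asum f -> Sum (fun x => c * f x) = c * Sum f.
Proof.
move=> sf; wlog c0 : c / 0 <= c.
  move=> H; case: (leP 0 c) => [|/ltW c0]; first exact: H.
  apply: oppr_inj; have := H (- c); rewrite oppr_ge0 mulNr => /(_ c0) <-.
  by rewrite -SumN; congr Sum; apply/funext => x; rewrite mulNr.
have sf' := asumN sf.
rewrite (@Sum_split _ (fun x => c * Num.max (f x) 0)
  (fun x => c * Num.max (- f x) 0)); last first.
- by move=> x; rewrite -mulrBr max0_sub.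
- by move=> x; rewrite mulr_ge0 ?max0_ge0.
- by move=> x; rewrite mulr_ge0 ?max0_ge0.
- by apply/asumZ/asum_pos.
- by apply/asumZ/asum_pos.
rewrite !nnsumZ /Sum ?mulrBr //; try exact: asum_pos.
all: by move=> x; exact: max0_ge0.
Qed.

Lemma Sum_ge0 f : asum f -> (forall x, 0 <= f x) -> 0 <= Sum f.
Proof. by move=> sf f0; rewrite Sum_ge0E // nnsum_ge0. Qed.

Lemma SumB f g : asum f -> asum g -> Sum (fun x => f x - g x) = Sum f - Sum g.
Proof. by move=> sf sg; rewrite SumD ?SumN //; apply: asumN. Qed.

Lemma le_Sum f g : asum f -> asum g -> (forall x, f x <= g x) ->
  Sum f <= Sum g.
Proof.
move=> sf sg fg; rewrite -subr_ge0 -SumB //; apply: Sum_ge0 => [|x].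
  exact: asumB.
by rewrite subr_ge0.
Qed.

Lemma asum0 : asum (fun=> 0).
Proof. by rewrite /asum esum1 ?ltry // => x _; rewrite normr0. Qed.

Lemma asum_sum (I : Type) (r : seq I) (F : I -> T -> R) :
  (forall i, asum (F i)) -> asum (fun x => \sum_(i <- r) F i x).
Proof.
move=> sF; elim: r => [|i r IH].
  by apply: asum_le asum0 _ => x; rewrite big_nil.
by apply: asum_le (asumD (sF i) IH) _ => x; rewrite big_cons.
Qed.

Lemma Sum_sum (I : Type) (r : seq I) (F : I -> T -> R) :
  (forall i, asum (F i)) ->
  Sum (fun x => \sum_(i <- r) F i x) = \sum_(i <- r) Sum (F i).
Proof.
move=> sF; elim: r => [|i r IH].
  rewrite big_nil Sum_ge0E //; last by move=> x; rewrite big_nil.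
    by rewrite /nnsum esum1 // => x _; rewrite big_nil.
  by apply: asum_le asum0 _ => x; rewrite big_nil.
rewrite big_cons -IH -SumD //; last exact: asum_sum.
by congr Sum; apply/funext => x; rewrite big_cons.
Qed.

Lemma asum_comp (e e' : T -> T) f : cancel e e' -> cancel e' e ->
  asum f -> asum (fun x => f (e x)).
Proof.
move=> eK e'K; rewrite /asum (reindex_esum [set: T] _ e) //.
by split => // [x y _ _ /(can_inj eK)//|x _]; exists (e' x).
Qed.

Lemma Sum_comp (e e' : T -> T) f : cancel e e' -> cancel e' e ->
  Sum (fun x => f (e x)) = Sum f.
Proof.
move=> eK e'K; have be : set_bij [set: T] [set: T] e.
  by split => // [x y _ _ /(can_inj eK)//|x _]; exists (e' x).
by rewrite /Sum /nnsum; congr (fine _ - fine _);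
  rewrite [RHS](reindex_esum [set: T] _ e).
Qed.

Lemma esum_point (F : T -> \bar R) a : (0 <= F a)%E ->
  (\esum_(x in [set: T]) (if a == x then F x else 0) = F a)%E.
Proof.
move=> Fa; rewrite -(esum_set1 Fa) [RHS]esum_mkcond; apply: eq_esum => x _.
by congr (if _ then _ else _); apply/eqP/idP => [->|/set_mem ->]; rewrite ?inE.
Qed.

(** The finite sum over [I] is written as an unordered sum of point masses and compared with [f]
    point by point; repeated values of [e] only enlarge it. *)
Lemma asum_support (I : finType) (e : I -> T) f :
  (forall x, f x != 0 -> exists i, x = e i) -> asum f.
Proof.
move=> supp.
have : (\sum_(i : I) (`|f (e i)|)%:E < +oo)%E by rewrite sumEFin ltry.
apply: le_lt_trans.
rewrite (eq_bigr (fun i => \esum_(x in [set: T])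
    (if e i == x then (`|f x|)%:E else 0))%E); last first.
  by move=> i _; rewrite esum_point // lee_fin.
rewrite -esum_sum; last by move=> x i _ _; case: ifP; rewrite // lee_fin.
apply: le_esum => x _; have [->|/supp [i ->]] := eqVneq (f x) 0.
  by rewrite normr0 sume_ge0 // => i _; case: ifP.
rewrite (bigD1 i) //= eqxx leeDl // sume_ge0 // => j _.
by case: ifP; rewrite // lee_fin.
Qed.

Lemma Sum_support_le (I : finType) (e : I -> T) f :
  (forall x, 0 <= f x) ->
  (forall x, f x != 0 -> exists i, x = e i) -> Sum f <= \sum_(i : I) f (e i).
Proof.
move=> f0 supp; rewrite Sum_ge0E //; last exact: asum_support supp.
rewrite -[leRHS]/(fine (_)%:E); apply: fine_le; rewrite ?asum_fin //.
  exact: asum_support supp.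
rewrite -sumEFin (eq_bigr (fun i => \esum_(x in [set: T])
    (if e i == x then (f x)%:E else 0))%E); last first.
  by move=> i _; rewrite (@esum_point (fun x => (f x)%:E)) // lee_fin.
rewrite -esum_sum; last by move=> x i _ _; case: ifP; rewrite // lee_fin.
apply: le_esum => x _; have [->|/supp [i ->]] := eqVneq (f x) 0.
  by rewrite sume_ge0 // => i _; case: ifP.
rewrite (bigD1 i) //= eqxx leeDl // sume_ge0 // => j _.
by case: ifP; rewrite // lee_fin.
Qed.

Lemma sum_inj_le_Sum (I : finType) (P : pred I) (e : I -> T) f :
  {in P &, injective e} -> asum f -> (forall x, 0 <= f x) ->
  \sum_(i | P i) f (e i) <= Sum f.
Proof.
move=> e_inj sf f0; rewrite Sum_ge0E //.
rewrite -[leLHS]/(fine (_)%:E); apply: fine_le; rewrite ?asum_fin //.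
rewrite -sumEFin (eq_bigr (fun i => \esum_(x in [set: T])
    (if e i == x then (f x)%:E else 0))%E); last first.
  by move=> i _; rewrite (@esum_point (fun x => (f x)%:E)) // lee_fin.
rewrite -esum_sum; last by move=> x i _ _; case: ifP; rewrite // lee_fin.
apply: le_esum => x _.
have [[i [Pi <-]]|nex] := pselect (exists i, P i /\ e i = x); last first.
  rewrite big1 ?lee_fin // => i Pi; case: eqP => // ei.
  by case: nex; exists i.
rewrite (bigD1 i) //= eqxx big1 ?adde0 // => j /andP[Pj ji].
by case: eqP => // /e_inj eji; rewrite eji ?eqxx // in ji.
Qed.

Lemma Sum_ge_term f a : asum f -> (forall x, 0 <= f x) -> f a <= Sum f.
Proof.
move=> sf f0; have /= := @sum_inj_le_Sum unit xpredT (fun=> a) f _ sf f0.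
by rewrite (big_pred1 tt) => [|[]] //; apply; case=> [] [].
Qed.

End AbsoluteSums.

(* Unification would otherwise unfold sums into suprema over finite sets. *)
Opaque asum nnsum Sum.

(** * Nonnegativity of the form from the resolvent set *)

Section SquareSummable.
Variables (R : realType) (T : choiceType).
Implicit Types f g h : T -> R.

Definition sqsum f : Prop := asum (fun x => f x ^+ 2).

Definition ip f g : R := Sum (fun x => f x * g x).

(** Named, and later opaque, so that rewriting by bilinearity of [ip] can recognise linear
    combinations. *)
Definition lin f (c : R) g : T -> R := fun x => f x + c * g x.

Lemma asum_mul f g : sqsum f -> sqsum g -> asum (fun x => f x * g x).
Proof.
move=> sf sg; apply: asum_dom (asumD sf sg) _ => x /=.
by rewrite ler_norml; apply/andP; split; nra.
Qed.

Lemma linE f c g x : lin f c g x = f x + c * g x.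
Proof. by []. Qed.

Lemma sqsum_lin f c g : sqsum f -> sqsum g -> sqsum (lin f c g).
Proof.
move=> sf sg.
apply: asum_dom (asumD (asumZ 2 sf) (asumZ (2 * c ^+ 2) sg)) _ => x /=.
rewrite ger0_norm ?sqr_ge0 // linE.
by have := sqr_ge0 (f x - c * g x); nra.
Qed.

Lemma sqsum0 : sqsum (fun=> 0).
Proof. by apply: asum_le (asum0 R T) _ => x; rewrite expr0n. Qed.

Lemma sqsum_le g f : sqsum g -> (forall x, `|f x| <= `|g x|) -> sqsum f.
Proof.
move=> sg fg; apply: asum_le sg _ => x.
by rewrite !normrX lerXn2r ?nnegrE.
Qed.

Lemma sqsumD f g : sqsum f -> sqsum g -> sqsum (fun x => f x + g x).
Proof.
move=> sf sg; apply: sqsum_le (sqsum_lin 1 sf sg) _ => x.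
by rewrite linE mul1r.
Qed.

Lemma sqsumZ c f : sqsum f -> sqsum (fun x => c * f x).
Proof.
move=> sf; apply: sqsum_le (sqsum_lin c sqsum0 sf) _ => x.
by rewrite linE add0r.
Qed.

Lemma sqsum_sum (I : Type) (r : seq I) (F : I -> T -> R) :
  (forall i, sqsum (F i)) -> sqsum (fun x => \sum_(i <- r) F i x).
Proof.
move=> sF; elim: r => [|i r IH].
  by apply: sqsum_le sqsum0 _ => x; rewrite big_nil.
by apply: sqsum_le (sqsumD (sF i) IH) _ => x; rewrite big_cons.
Qed.

Lemma ipC f g : ip f g = ip g f.
Proof. by congr Sum; apply/funext => x; rewrite mulrC. Qed.

Lemma ip_linl f c g h : sqsum f -> sqsum g -> sqsum h ->
  ip (lin f c g) h = ip f h + c * ip g h.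
Proof.
move=> sf sg sh; rewrite /ip -SumZ; last exact: asum_mul.
rewrite -SumD; [|exact: asum_mul|by apply/asumZ/asum_mul].
by congr Sum; apply/funext => x; rewrite linE mulrDl mulrA.
Qed.

Lemma ip_linr f c g h : sqsum f -> sqsum g -> sqsum h ->
  ip h (lin f c g) = ip h f + c * ip h g.
Proof. by move=> sf sg sh; rewrite !(ipC h) ip_linl. Qed.

Lemma ip_ge0 f : sqsum f -> 0 <= ip f f.
Proof.
by move=> sf; apply: Sum_ge0 => [|x]; [exact: asum_mul|rewrite -expr2 sqr_ge0].
Qed.

End SquareSummable.

Opaque lin.

(** * The bottom of the numerical range of a bounded inverse *)

Section SpectralBottom.
Variables (R : realType) (T : choiceType).
Variable D : (T -> R) -> Prop.
Hypothesis D_sq : forall f, D f -> sqsum f.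
Hypothesis D_lin : forall f c g, D f -> D g -> D (lin f c g).

(** With [B = A^-1] and [g = A f], the form of [A] at [f] is that of [B] at [g], and [f + m A f] is
    [S g] for [S = B + m]. If [- m < 0] were the infimum of the numerical range of [B], then
    [0 <= S <= K] would give [S^2 <= K S], and the lower bound on [S] would make the form of [S]
    strictly positive. *)
Lemma bounded_inverse_form_ge0 (A : (T -> R) -> T -> R) (c : R) :
  (forall f, D f -> sqsum (A f)) ->
  (forall f k g, A (lin f k g) = lin (A f) k (A g)) ->
  (forall f g, D f -> D g -> ip (A f) g = ip f (A g)) ->
  (forall g, sqsum g -> exists2 f, D f & A f = g) ->
  (forall f, D f -> ip f f <= c * ip (A f) (A f)) ->
  (forall m, 0 < m -> exists c', forall f, D f ->
    ip f f <= c' * ip (lin f m (A f)) (lin f m (A f))) ->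
  forall f, D f -> 0 <= ip (A f) f.
Proof.
move=> A_sq A_lin A_sym surj bnd bndm.
pose N f := ip (A f) (A f); pose a f := ip (A f) f.
have N_ge0 f : D f -> 0 <= N f by move=> /A_sq /ip_ge0.
have absA f : D f -> - (2 * a f) <= N f + ip f f /\ 2 * a f <= N f + ip f f.
  move=> Df; have [sf sA] := (D_sq Df, A_sq _ Df).
  have := ip_ge0 (sqsum_lin 1 sA sf); have := ip_ge0 (sqsum_lin (- 1) sA sf).
  rewrite !(ip_linl, ip_linr) //; try exact: sqsum_lin.
  by rewrite /N /a (ipC f); lra.
(* Young's inequality bounds the numerical range of [B]: the absolute value of [a f] is at most
   [c0 * N f]. *)
pose c0 := (1 + Num.max c 0) / 2.
have c0_gt0 : 0 < c0 by have := max0_ge0 c; rewrite /c0; lra.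
have c0N f : D f -> N f + ip f f <= 2 * c0 * N f.
  move=> Df; have := bnd f Df; rewrite -/(N f).
  have : c * N f <= Num.max c 0 * N f.
    by rewrite ler_wpM2r ?N_ge0 // le_max lexx.
  by rewrite /c0; lra.
move=> f0 Df0; rewrite -/(a f0) leNgt; apply/negP => a0.
pose M := [set m : R | forall f, D f -> - m * N f <= a f].
have Mc0 : M c0.
  by move=> f Df; have := absA f Df; have := c0N f Df; lra.
have N0 : 0 < N f0.
  rewrite lt_neqAle N_ge0 // andbT; apply/eqP => N0.
  by have := Mc0 f0 Df0; rewrite -N0; lra.
have lbM : lbound M (- a f0 / N f0).
  by move=> m /(_ f0 Df0); rewrite ler_pdivrMr //; lra.
pose m := inf M.
have infM : has_inf M by split; [exists c0|exists (- a f0 / N f0)].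
have m_gt0 : 0 < m.
  apply: (@lt_le_trans _ _ (- a f0 / N f0)); first by rewrite divr_gt0 //; lra.
  by apply: lb_le_inf => //; exists c0.
have Mm : M m.
  move=> f Df; have [N00|Nf0] := eqVneq (N f) 0.
    by have := Mc0 f Df; rewrite N00; lra.
  have Nf : 0 < N f by rewrite lt_neqAle eq_sym Nf0 N_ge0.
  suff : - a f / N f <= m by rewrite ler_pdivrMr //; lra.
  apply: lb_le_inf => [|k /(_ f Df)]; first by exists c0.
  by rewrite ler_pdivrMr //; lra.
pose K := m + c0; have K_gt0 : 0 < K by rewrite addr_gt0.
(* The inequality [S^2 <= K S]: nonnegativity of [S] is tested at [A f - K^-1 g], which is the image
   under [A] of [f - K^-1 h]. *)
have gap f : D f -> ip (lin f m (A f)) (lin f m (A f)) <= K * (a f + m * N f).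
  move=> Df; set g := lin f m (A f); have gE : g = lin f m (A f) by [].
  have [sf sA] := (D_sq Df, A_sq _ Df).
  have sg : sqsum g by exact: sqsum_lin.
  clearbody g.
  have [h Dh Ah] := surj g sg.
  have sh := D_sq Dh.
  have gg : ip g g = ip f g + m * ip (A f) g.
    by rewrite {1}gE ip_linl.
  have := Mm _ (D_lin (- K^-1) Df Dh).
  rewrite /a /N A_lin Ah !(ip_linl, ip_linr) //; try exact: sqsum_lin.
  have -> : ip (A f) h = ip f g by rewrite A_sym // Ah.
  rewrite (ipC g f) (ipC g (A f)) -/(a f) -/(N f).
  have : ip g h <= c0 * ip g g.
    have [_] := absA h Dh; have := c0N h Dh.
    by rewrite /a /N Ah; lra.
  have e1 : m * ip (A f) g = ip g g - ip f g by lra.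
  move=> gh /(ler_wpM2l (ltW K_gt0)).
  have KK : K * K^-1 = 1 by rewrite divff ?gt_eqF.
  have gg0 : 0 <= ip g g by exact: ip_ge0.
  have Ki : 0 < K^-1 by rewrite invr_gt0.
  have : K^-1 * (ip g h + m * ip g g) <= ip g g.
    by rewrite mulrC ler_pdivrMr // /K; lra.
  move: KK e1; set k := K^-1; set G := ip g g; set q := ip (A f) g.
  move=> KK e1 b1 b2.
  have : K * (a f + m * N f) - 2 * (K * k) * (ip f g + m * q) +
    (K * k) * (k * (ip g h + m * G)) >= 0 by move: b2; rewrite /G; nra.
  by rewrite KK; lra.
have [c' Hc'] := bndm m m_gt0.
(* [m A f] is the difference of [f + m A f] and [f]; the second is controlled by the first through
   [bndm], and the first by [gap]. Hence [m^2 N f <= C (a f + m N f)], which puts a number below [m]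
   into [M]. *)
pose C := 2 * K * (1 + Num.max c' 0).
have C_gt0 : 0 < C by rewrite !mulr_gt0 // ltr_pwDl ?max0_ge0.
have : M (m - m ^+ 2 / C).
  move=> f Df; set g := lin f m (A f).
  have [sf sA] := (D_sq Df, A_sq _ Df).
  have G0 : 0 <= ip g g by apply/ip_ge0/sqsum_lin.
  have := ip_ge0 (sqsum_lin (m / 2) sf sA).
  have gE : ip g g = ip f f + 2 * m * a f + m ^+ 2 * N f.
    rewrite /g !(ip_linl, ip_linr) //; try exact: sqsum_lin.
    by rewrite (ipC f) -/(a f) -/(N f); ring.
  rewrite !(ip_linl, ip_linr) //; try exact: sqsum_lin.
  rewrite (ipC f) -/(a f) -/(N f) => young.
  have P_le : ip f f <= Num.max c' 0 * ip g g.
    by apply: le_trans (Hc' f Df) _; rewrite ler_wpM2r // le_max lexx.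
  have : m ^+ 2 * N f <= C * (a f + m * N f).
    have : m ^+ 2 * N f <= 2 * (1 + Num.max c' 0) * ip g g by nra.
    move=> /le_trans; apply.
    rewrite /C [2 * K]mulrC -!mulrA mulrCA.
    have := gap f Df; rewrite -/g => /(ler_wpM2l _) b.
    rewrite !mulrA; have := b (2 * (1 + Num.max c' 0)).
    by have := max0_ge0 c'; nra.
  by rewrite -ler_pdivrMl //; lra.
move=> /(ge_inf (proj2 infM)); rewrite -/m.
have : 0 < m ^+ 2 / C by rewrite divr_gt0 ?exprn_gt0.
by lra.
Qed.

Variable H : (T -> R) -> T -> R.
Hypothesis H_sq : forall f, D f -> sqsum (H f).
Hypothesis H_lin : forall f c g, H (lin f c g) = lin (H f) c (H g).
Hypothesis H_sym : forall f g, D f -> D g -> ip (H f) g = ip f (H g).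

Lemma form_ge0 :
  (forall x, x < 0 -> forall g, sqsum g ->
    exists2 f, D f & lin (H f) (- x) f = g) ->
  (forall x, x < 0 -> exists c, forall f, D f ->
    ip f f <= c * ip (lin (H f) (- x) f) (lin (H f) (- x) f)) ->
  forall f, D f -> 0 <= ip (H f) f.
Proof.
move=> surj bnd f Df; apply/ler_addgt0Pl => e e0.
have [sf sH] := (D_sq Df, H_sq Df).
have p0 : 0 < ip f f + 1 by rewrite ltr_wpDl ?ip_ge0.
(* Chosen negative with [- x * ip f f <= e]. *)
pose x := - (e / (ip f f + 1)).
have x0 : x < 0 by rewrite oppr_lt0 divr_gt0.
have [c Hc] := bnd _ x0.
have : 0 <= ip (lin (H f) (- x) f) f.
  apply: (bounded_inverse_form_ge0 (A := fun f => lin (H f) (- x) f) (c := c)) => //.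
  - by move=> g Dg; apply: sqsum_lin; [exact: H_sq|exact: D_sq].
  - move=> g k h; rewrite H_lin; apply/funext => n.
    by rewrite !linE; ring.
  - move=> g h Dg Dh; have [sg sh] := (D_sq Dg, D_sq Dh).
    have [sHg sHh] := (H_sq Dg, H_sq Dh).
    by rewrite ip_linl // ip_linr // H_sym.
  - exact: surj.
  (* [g + m (H - x) g] is [m] times [(H - (x - 1/m)) g], and [x - 1/m] is again negative. *)
  move=> m m0; have xm : x - m^-1 < 0 by rewrite subr_lt0 (lt_trans x0) ?invr_gt0.
  have [c' Hc'] := bnd _ xm.
  exists (c' * m^-1 ^+ 2) => g Dg; apply: le_trans (Hc' g Dg) _.
  have [sg sHg] := (D_sq Dg, H_sq Dg).
  set w := lin g m _; have sw : sqsum w by do 2! apply: sqsum_lin => //.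
  have -> : lin (H g) (- (x - m^-1)) g = (fun n => m^-1 * w n).
    by apply/funext => n; rewrite /w !linE; field; rewrite gt_eqF.
  rewrite -mulrA le_eqVlt; apply/orP; left; apply/eqP; congr (_ * _).
  rewrite /ip -SumZ; last exact: asum_mul.
  by congr Sum; apply/funext => n; ring.
rewrite ip_linl // opprK => /le_trans; apply.
rewrite addrC lerD2r mulrAC ler_pdivrMr // ler_pM2l //.
by rewrite lerDl.
Qed.

End SpectralBottom.

(** * Reduction to real functions *)

Section RealHamiltonian.
Variables (R : realType) (d : nat).
Local Notation Z := 'rV[int]_d.
Implicit Types (f g : Z -> R) (n m : Z) (V : Z -> R).

Definition nbsum f n : R := \sum_(j < d) (f (n + delta j) + f (n - delta j)).

(** The action of [H_V] on real functions; since its coefficients are real, the analysis can be done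
    over [R]. *)
Definition rham V f n : R := 2 * d%:R * f n - nbsum f n + V n * f n.

Definition rdom V f : Prop := sqsum f /\ sqsum (fun n => V n * f n).

Lemma shiftK (a : Z) : cancel (fun n => n + a) (fun n => n - a).
Proof. by move=> n; rewrite addrK. Qed.

Lemma shiftKV (a : Z) : cancel (fun n => n - a) (fun n => n + a).
Proof. by move=> n; rewrite subrK. Qed.

Lemma sqsum_shift f (a : Z) : sqsum f -> sqsum (fun n => f (n + a)).
Proof. exact: (asum_comp (@shiftK a) (@shiftKV a)). Qed.

Lemma sqsum_nbsum f : sqsum f -> sqsum (nbsum f).
Proof.
by move=> sf; apply: sqsum_sum => j; apply: sqsumD; apply: sqsum_shift.
Qed.

Lemma ip_shift f g (a : Z) :
  ip (fun n => f (n + a)) g = ip f (fun n => g (n - a)).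
Proof.
rewrite /ip -(Sum_comp _ (@shiftKV a) (@shiftK a)).
by congr Sum; apply/funext => n; rewrite subrK.
Qed.

Lemma ip_nbsum f g : sqsum f -> sqsum g -> ip (nbsum f) g = ip f (nbsum g).
Proof.
have expand h k : sqsum h -> sqsum k -> ip (nbsum h) k =
    \sum_(j < d) (ip (fun n => h (n + delta j)) k +
                  ip (fun n => h (n - delta j)) k).
  move=> sh sk; rewrite /ip.
  have sm (a : Z) : asum (fun n => h (n + a) * k n).
    by apply: asum_mul => //; apply: sqsum_shift.
  under eq_bigr do rewrite -SumD //.
  rewrite -Sum_sum => [|j]; last exact: asumD.
  congr Sum; apply/funext => n; rewrite /nbsum mulr_suml.
  by apply: eq_bigr => j _; rewrite mulrDl.
move=> sf sg; rewrite expand // ipC expand //; apply: eq_bigr => j _.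
rewrite addrC ![ip _ f]ipC; congr (_ + _); rewrite ip_shift //.
by congr ip; apply/funext => n; rewrite opprK.
Qed.

Lemma sqsum_rham V f : rdom V f -> sqsum (rham V f).
Proof.
move=> [sf sVf]; apply: sqsumD => //; apply: sqsumD; first exact: sqsumZ.
apply: sqsum_le (sqsum_nbsum sf) _ => n; by rewrite normrN.
Qed.

Lemma nbsum_lin f c g : nbsum (lin f c g) = lin (nbsum f) c (nbsum g).
Proof.
apply/funext => n; rewrite linE /nbsum mulr_sumr -big_split.
by apply: eq_bigr => j _ /=; rewrite !linE; ring.
Qed.

Lemma rham_lin V f c g : rham V (lin f c g) = lin (rham V f) c (rham V g).
Proof.
by apply/funext => n; rewrite linE /rham nbsum_lin !linE; ring.
Qed.

Lemma rdom_lin V f c g : rdom V f -> rdom V g -> rdom V (lin f c g).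
Proof.
move=> [sf sVf] [sg sVg]; split; first exact: sqsum_lin.
apply: sqsum_le (sqsum_lin c sVf sVg) _ => n.
by rewrite !linE mulrDr mulrCA.
Qed.

Lemma ip_rham V f g : rdom V f -> sqsum g -> ip (rham V f) g =
  2 * d%:R * ip f g - ip (nbsum f) g + ip (fun n => V n * f n) g.
Proof.
move=> [sf sVf] sg; have -> : rham V f = lin (lin (fun n => V n * f n)
    (2 * d%:R) f) (- 1) (nbsum f).
  by apply/funext => n; rewrite /rham !linE; ring.
have snf := sqsum_nbsum sf.
rewrite !ip_linl //; first by ring.
exact: sqsum_lin.
Qed.

Lemma rham_sym V f g : rdom V f -> rdom V g -> ip (rham V f) g = ip f (rham V g).
Proof.
move=> df dg; rewrite (ipC f) !ip_rham //; [|exact: (proj1 df)|exact: (proj1 dg)].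
rewrite (ip_nbsum (proj1 df) (proj1 dg)) (ipC g f) (ipC (nbsum g) f).
congr (_ + _).
by congr Sum; apply/funext => n; ring.
Qed.

Lemma sum_sq_ge0 n : 0 <= \sum_(j < d) ((n ord0 j)%:~R : R) ^+ 2.
Proof. by apply: sumr_ge0 => j _; rewrite sqr_ge0. Qed.

Lemma enorm_sqr n : enorm R n ^+ 2 = \sum_(j < d) (n ord0 j)%:~R ^+ 2.
Proof. by rewrite sqr_sqrtr ?sum_sq_ge0. Qed.

Lemma enorm_ge0 n : 0 <= enorm R n.
Proof. exact: sqrtr_ge0. Qed.

(** The boolean is the sign; the pairs form a finite type indexing the [2 d] nearest neighbours of
    0. *)
Definition unit_step (p : 'I_d * bool) : Z :=
  if p.2 then delta p.1 else - delta p.1.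

Lemma unit_stepE p k :
  unit_step p ord0 k = (if p.2 then 1 else - 1) * (k == p.1)%:R.
Proof.
case: p => j []; rewrite /unit_step /= ?mxE ?eqxx ?mul1r //.
by rewrite mulN1r.
Qed.

Lemma unit_step_inj : injective unit_step.
Proof.
move=> [i a] [j b] /matrixP /(_ ord0 i).
rewrite !unit_stepE /= eqxx mulr1.
by case: eqP => [->|_]; case: a; case: b.
Qed.

Lemma enorm_unit_step p : enorm R (unit_step p) = 1.
Proof.
rewrite /enorm (bigD1 p.1) //= unit_stepE eqxx big1 ?addr0.
  by case: p.2; rewrite mulr1 ?rmorphN ?sqrrN expr1n sqrtr1.
by move=> k kp; rewrite unit_stepE (negPf kp) mulr0 expr0n.
Qed.

(** The squares of the integer coordinates sum to 1: a nonzero coordinate already contributes 1 and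
    leaves nothing for the others. *)
Lemma enorm_eq1 m : enorm R m = 1 -> exists p, m = unit_step p.
Proof.
move=> m1; have : (\sum_(j < d) m ord0 j ^+ 2)%:~R = 1%:~R :> R.
  transitivity (enorm R m ^+ 2); last by rewrite m1 expr1n.
  rewrite enorm_sqr rmorph_sum.
  by apply: eq_bigr => j _; rewrite rmorphXn.
move=> /intr_inj s1.
have [j mj] : exists j, m ord0 j != 0.
  apply: contrapT => nex; move: s1; rewrite big1 // => j _.
  by apply/eqP; rewrite expf_eq0 /=; apply: contra_notT nex; exists j.
move: s1; rewrite (bigD1 j) //=; set rest := (X in _ + X) => s1.
have rest0 : 0 <= rest by apply: sumr_ge0 => i _; rewrite sqr_ge0.
have mj1 : 1 <= m ord0 j ^+ 2 by rewrite -gtz0_ge1 exprn_even_gt0.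
have r0 : rest = 0 by lia.
have mjE : m ord0 j ^+ 2 = 1 by lia.
exists (j, m ord0 j == 1); apply/matrixP => i k; rewrite ord1 unit_stepE /=.
have [->|kj] := eqVneq k j.
  rewrite mulr1; move/eqP: mjE; rewrite sqrf_eq1.
  by case: eqP => //= _ /eqP.
rewrite mulr0; have := psumr_eq0P _ r0 => /(_ (fun i _ => sqr_ge0 _)) /(_ k kj).
by move/eqP; rewrite expf_eq0 /= => /eqP.
Qed.

Lemma neg_laplacianE (psi : Z -> R[i]) n : neg_laplacian psi n =
  \sum_(j < d) ((psi n - psi (n + delta j)) + (psi n - psi (n - delta j))).
Proof.
rewrite /neg_laplacian (reindex_fsbig (fun p => n + unit_step p) [set: 'I_d * bool]).
  rewrite (@fsbig_fwiden _ _ _ _ (index_enum _)) ?index_enum_uniq //; last 2 first.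
  - by move=> p _ /=; rewrite mem_index_enum.
  - by move=> p [_ /(_ Logic.I)].
  transitivity (\sum_(j < d) \sum_(b : bool) (psi n - psi (n + unit_step (j, b)))).
    by rewrite pair_bigA; apply: eq_bigr => -[].
  by apply: eq_bigr => j _; rewrite big_bool.
split=> [p _ /=|p q _ _ /addrI /unit_step_inj //|m /= /enorm_eq1 [p mp]].
  by rewrite addrC addKr enorm_unit_step.
by exists p => //; rewrite -mp addrC subrK.
Qed.

Lemma cmod_sqr (z : R[i]) : cmod z ^+ 2 = complex.Re z ^+ 2 + complex.Im z ^+ 2.
Proof. by case: z => a b; rewrite /cmod /= sqr_sqrtr // addr_ge0 ?sqr_ge0. Qed.

Lemma cmod_real (x : R) : cmod x%:C%C ^+ 2 = x ^+ 2.
Proof. by rewrite cmod_sqr /= expr0n addr0. Qed.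

Definition realify f : Z -> R[i] := fun n => (f n)%:C%C.

Lemma l2_realify f : l2 (realify f) <-> sqsum f.
Proof.
rewrite /l2 /= /l2sqnorm /sqsum asumE.
under eq_esum do rewrite cmod_real.
by under [X in _ <-> is_true (X < _)%E]eq_esum do rewrite ger0_norm ?sqr_ge0 //.
Qed.

Lemma sqsum_part (pr : R[i] -> R) (psi : Z -> R[i]) :
  (forall z, pr z ^+ 2 <= cmod z ^+ 2) -> l2 psi -> sqsum (fun n => pr (psi n)).
Proof.
move=> prle; rewrite /l2 /= => lpsi; apply/asumE; apply: le_lt_trans lpsi.
by apply: le_esum => n _; rewrite lee_fin ger0_norm ?sqr_ge0.
Qed.

Lemma l2norm_realify f : sqsum f -> l2norm (realify f) = Num.sqrt (ip f f).
Proof.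
move=> sf; rewrite /l2norm /ip Sum_ge0E; last 2 first.
- exact: asum_mul.
- by move=> n; rewrite -expr2 sqr_ge0.
congr (Num.sqrt (fine _)); apply: eq_esum => n _.
by rewrite cmod_real expr2.
Qed.

Lemma schrodinger_realify V f : schrodinger V (realify f) = realify (rham V f).
Proof.
apply/funext => n; rewrite /schrodinger neg_laplacianE /mulop /realify /rham.
rewrite rmorphD rmorphM; congr (_ + _).
have -> : 2 * d%:R * f n - nbsum f n =
    \sum_(j < d) ((f n - f (n + delta j)) + (f n - f (n - delta j))).
  rewrite /nbsum -sumrN -[2 * _ * _](_ : \sum_(j < d) (2 * f n) = _).
    by rewrite -big_split; apply: eq_bigr => j _ /=; ring.
  by rewrite sumr_const card_ord -mulr_natl; ring.
by rewrite rmorph_sum; apply: eq_bigr => j _; rewrite rmorphD !rmorphB.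
Qed.

Section Part.
Variable pr : R[i] -> R.
Hypothesis prD : forall z w, pr (z + w) = pr z + pr w.
Hypothesis prM : forall x z, pr (x%:C%C * z) = x * pr z.

(** Meant for [pr] the real or the imaginary part, both of which commute with an operator having
    real coefficients. *)
Lemma part_schrodinger V psi n :
  pr (schrodinger V psi n) = rham V (fun m => pr (psi m)) n.
Proof.
have pr0 : pr 0 = 0 by have := prD 0 0; rewrite addr0; lra.
have prB z w : pr (z - w) = pr z - pr w.
  by rewrite prD -mulN1r -[- 1](_ : (- 1)%:C%C = _) ?prM ?mulN1r // rmorphN.
rewrite /schrodinger neg_laplacianE /mulop prD prM /rham; congr (_ + _).
rewrite (big_morph pr prD pr0) /nbsum.
transitivity (\sum_(j < d) (2 * pr (psi n)) -
    \sum_(j < d) (pr (psi (n + delta j)) + pr (psi (n - delta j)))).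
  rewrite -sumrN -big_split; apply: eq_bigr => j _ /=.
  by rewrite prD !prB; ring.
by rewrite sumr_const card_ord -mulr_natl; congr (_ - _); ring.
Qed.

End Part.

Lemma ReD (z w : R[i]) : complex.Re (z + w) = complex.Re z + complex.Re w.
Proof. by case: z; case: w. Qed.

Lemma ImD (z w : R[i]) : complex.Im (z + w) = complex.Im z + complex.Im w.
Proof. by case: z; case: w. Qed.

Lemma ReZ (x : R) (z : R[i]) : complex.Re (x%:C%C * z) = x * complex.Re z.
Proof. by case: z => a b /=; ring. Qed.

Lemma ImZ (x : R) (z : R[i]) : complex.Im (x%:C%C * z) = x * complex.Im z.
Proof. by case: z => a b /=; ring. Qed.

Lemma Re_le_cmod (z : R[i]) : complex.Re z ^+ 2 <= cmod z ^+ 2.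
Proof. by rewrite cmod_sqr lerDl sqr_ge0. Qed.

Lemma Im_le_cmod (z : R[i]) : complex.Im z ^+ 2 <= cmod z ^+ 2.
Proof. by rewrite cmod_sqr lerDr sqr_ge0. Qed.

Lemma rdom_part (pr : R[i] -> R) V psi :
  (forall z, pr z ^+ 2 <= cmod z ^+ 2) ->
  (forall x z, pr (x%:C%C * z) = x * pr z) ->
  mulop_dom V psi -> rdom V (fun n => pr (psi n)).
Proof.
move=> prle prM [lpsi lVpsi]; split; first exact: sqsum_part lpsi.
apply: sqsum_le (sqsum_part prle lVpsi) _ => n.
by rewrite /mulop prM.
Qed.

Lemma real_eigenfunction V :
  point_spectrum (mulop_dom V) (schrodinger V) 0 ->
  exists f n, [/\ rdom V f, f n != 0 & forall m, rham V f m = 0].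
Proof.
move=> [psi [dpsi psi0 Hpsi]].
have [n psin] : exists n, psi n != 0.
  apply: contrapT => nex; apply: psi0; apply/funext => n; apply/eqP.
  by apply: contra_notT nex; exists n.
have Hpsi0 m : schrodinger V psi m = 0 by rewrite Hpsi mul0r.
have [Re0|Re0] := eqVneq (complex.Re (psi n)) 0.
  exists (fun m => complex.Im (psi m)), n; split.
  - exact: rdom_part Im_le_cmod ImZ dpsi.
  - apply: contra_neq psin => Im0.
    by move: Re0 Im0; case: (psi n) => a b /= -> ->.
  - by move=> m; rewrite -(part_schrodinger ImD ImZ) Hpsi0.
exists (fun m => complex.Re (psi m)), n; split => //.
- exact: rdom_part Re_le_cmod ReZ dpsi.
- by move=> m; rewrite -(part_schrodinger ReD ReZ) Hpsi0.
Qed.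

Lemma shifted_realify V x f : shifted (schrodinger V) x%:C%C (realify f) =
  realify (lin (rham V f) (- x) f).
Proof.
apply/funext => n; rewrite /shifted schrodinger_realify /realify !linE.
by rewrite mulNr rmorphB rmorphM.
Qed.

(** Negative reals are in the resolvent set because the infimum is zero. Surjectivity descends to
    real functions: the real part of a complex preimage of a real function is a real preimage. *)
Lemma rham_form_ge0 V :
  inf_spectrum (mulop_dom V) (schrodinger V) = 0%E ->
  forall f, rdom V f -> 0 <= ip (rham V f) f.
Proof.
move=> inf0.
have resolv x : x < 0 -> resolvent_set (mulop_dom V) (schrodinger V) x%:C%C.
  move=> x0; apply: contrapT => spx.
  have : (inf_spectrum (mulop_dom V) (schrodinger V) <= x%:E)%E.
    by apply: ereal_inf_lbound; exists x.
  by rewrite inf0 lee_fin leNgt x0.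
have dsq f : rdom V f -> sqsum f by case.
apply: (@form_ge0 R Z (rdom V) dsq (@rdom_lin V) (rham V)).
- exact: sqsum_rham.
- exact: rham_lin.
- exact: rham_sym.
- move=> x x0 g sg; have [[_ _ surj] _] := resolv x x0.
  have [psi dpsi psig] := surj _ (proj2 (l2_realify g) sg).
  exists (fun n => complex.Re (psi n)); first exact: rdom_part Re_le_cmod ReZ dpsi.
  apply/funext => n; have /(congr1 (@complex.Re R)) := congr1 (@^~ n) psig.
  rewrite /shifted /realify /= -mulNr -[- _](rmorphN (real_complex R)).
  by rewrite ReD ReZ (part_schrodinger ReD ReZ).
- move=> x /resolv [_ [c Hc]]; exists (c ^+ 2) => f df.
  have [sf sVf] := df; have sH := sqsum_rham df.
  have sL : sqsum (lin (rham V f) (- x) f) by exact: sqsum_lin.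
  have /Hc : mulop_dom V (realify f).
    split; first by apply/l2_realify.
    have -> : mulop V (realify f) = realify (fun n => V n * f n).
      by apply/funext => n; rewrite /mulop /realify rmorphM.
    by apply/l2_realify.
  rewrite shifted_realify !l2norm_realify // => le1.
  have := ler_pM (sqrtr_ge0 _) (sqrtr_ge0 _) le1 le1.
  by rewrite -!expr2 exprMn !sqr_sqrtr ?ip_ge0.
Qed.

End RealHamiltonian.

(** * Positivity of the ground state *)

Section PositiveGroundState.
Variables (R : realType) (d : nat).
Local Notation Z := 'rV[int]_d.
Implicit Types (f g : Z -> R) (n m : Z) (V : Z -> R).

(** Connectedness of the lattice: [n - n0] is composed of unit steps, one coordinate at a time. *)
Lemma lattice_ind (P : Z -> Prop) n0 : P n0 ->
  (forall n p, P n -> P (n + unit_step p)) -> forall n, P n.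
Proof.
move=> Pn0 step n; rewrite -[n](subrK n0) addrC; move: (n - n0) => c.
rewrite [c]row_sum_delta.
have scale j (z : int) m : P m -> P (m + z *: delta j).
  case: z => k Pm.
    elim: k => [|k IH]; first by rewrite scale0r addr0.
    rewrite -[k.+1]addn1 PoszD scalerDl scale1r addrA.
    exact: (step _ (j, true)).
  rewrite NegzE; elim: k => [|k IH].
    by rewrite scaleN1r; exact: (step _ (j, false)).
  rewrite -[k.+2]addn1 PoszD opprD scalerDl scaleN1r addrA.
  exact: (step _ (j, false)).
elim: (index_enum _) n0 Pn0 => [|j r IH] m Pm; first by rewrite big_nil addr0.
by rewrite big_cons addrA; apply: IH; apply: scale.
Qed.

Definition point n : Z -> R := fun m => (n == m)%:R.

Lemma point_support n m : point n m != 0 -> exists i : unit, m = (fun=> n) i.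
Proof.
by rewrite /point; case: (n =P m) => [-> _|_]; [exists tt|rewrite eqxx].
Qed.

Lemma asum_point n : asum (point n).
Proof. exact: (@asum_support _ _ unit (fun=> n)) (@point_support n). Qed.

Lemma Sum_point n : Sum (point n) = 1.
Proof.
have p0 m : 0 <= point n m by rewrite ler0n.
apply/eqP; rewrite eq_le; apply/andP; split.
  apply: le_trans (Sum_support_le p0 (@point_support n)) _.
  by rewrite (big_pred1 tt) => [|[]] //; rewrite /point eqxx.
have := Sum_ge_term n (asum_point n) p0.
by rewrite {1}/point eqxx.
Qed.

Lemma ip_point f n : ip f (point n) = f n.
Proof.
rewrite -[RHS]mulr1 -(Sum_point n) -SumZ; last exact: asum_point.
congr Sum; apply/funext => m; rewrite /point.
by case: (n =P m) => [->//|_]; rewrite !mulr0.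
Qed.

Lemma sqsum_mul_point (F : Z -> R) n : sqsum (fun m => F m * point n m).
Proof.
apply: (@asum_support _ _ unit (fun=> n)) => m.
rewrite expf_eq0 /= mulf_eq0 negb_or => /andP[_].
exact: point_support.
Qed.

Lemma rdom_point V n : rdom V (point n).
Proof.
split; last exact: sqsum_mul_point.
by apply: sqsum_le (@sqsum_mul_point (fun=> 1) n) _ => m; rewrite mul1r.
Qed.

(** First variation in the direction of a point mass at [n]: by symmetry the linear coefficient of
    the form is [2 * rham V f n]. *)
Lemma minimizer_is_eigenfunction V f :
  (forall g, rdom V g -> 0 <= ip (rham V g) g) ->
  rdom V f -> ip (rham V f) f <= 0 -> forall n, rham V f n = 0.
Proof.
move=> form0 df fmin n; have dp := rdom_point V n.
have sf := proj1 df; have sp := proj1 dp.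
have sHf := sqsum_rham df; have sHp := sqsum_rham dp.
pose a := rham V f n; pose b := ip (rham V (point n)) (point n).
have quad t : 0 <= 2 * t * a + t ^+ 2 * b.
  have := form0 _ (rdom_lin t df dp); rewrite rham_lin.
  rewrite !(ip_linl, ip_linr) //; try exact: sqsum_lin.
  rewrite (rham_sym dp df) [ip (point n) _]ipC ip_point -/a -/b.
  by lra.
(* [B] dominates [b], so at [t = - a / B] the linear term outweighs the quadratic one unless
   [a = 0]. *)
pose B := `|b| + 1; have B0 : 0 < B by rewrite ltr_wpDl.
have := quad (- a / B).
have bB : b * B^-1 <= 1.
  by rewrite ler_pdivrMr // mul1r (le_trans (ler_norm b)) // lerDl.
have Bi : 0 < B^-1 by rewrite invr_gt0.
have -> : 2 * (- a / B) * a + (- a / B) ^+ 2 * b =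
    - (a ^+ 2 * B^-1 * (2 - b * B^-1)) by ring.
rewrite oppr_ge0 => le0; apply/eqP; rewrite -/a -sqrf_eq0 eq_le sqr_ge0 andbT.
move: le0; rewrite pmulr_lle0; last by lra.
by rewrite pmulr_lle0.
Qed.

Lemma positive_ground_state V f n0 :
  (forall g, rdom V g -> 0 <= ip (rham V g) g) ->
  rdom V f -> f n0 != 0 -> (forall n, rham V f n = 0) ->
  exists phi, [/\ sqsum phi, forall n, 0 < phi n & forall n, rham V phi n = 0].
Proof.
move=> form0 df fn0 Hf; pose phi n := `|f n|; have [sf sVf] := df.
have dphi : rdom V phi.
  split; first by apply: sqsum_le sf _ => n; rewrite normr_id.
  by apply: sqsum_le sVf _ => n; rewrite !normrM normr_id.
have sphi := proj1 dphi.
have Hphi : forall n, rham V phi n = 0.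
  apply: minimizer_is_eigenfunction => //.
  have : ip (rham V f) f = 0.
    rewrite /ip; have -> : (fun n => rham V f n * f n) = (fun n => 0 * point n0 n).
      by apply/funext => n; rewrite Hf !mul0r.
    by rewrite SumZ ?mul0r //; exact: asum_point.
  rewrite !ip_rham // => <-.
  have -> : ip phi phi = ip f f.
    by congr Sum; apply/funext => n; rewrite -!expr2 real_normK ?num_real.
  have -> : ip (fun n => V n * phi n) phi = ip (fun n => V n * f n) f.
    congr Sum; apply/funext => n; rewrite -!mulrA -!expr2.
    by rewrite real_normK ?num_real.
  (* Only the neighbour term distinguishes the two forms; it enters with a minus sign and grows by
     the triangle inequality. *)
  rewrite lerD2r lerD2l lerN2; apply: le_Sum.
  - by apply: asum_mul => //; exact: sqsum_nbsum.
  - by apply: asum_mul => //; exact: sqsum_nbsum.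
  move=> n; apply: le_trans (ler_norm _) _; rewrite normrM ler_wpM2r //.
  apply: le_trans (ler_norm_sum _ _ _) _; apply: ler_sum => j _.
  exact: ler_normD.
exists phi; split=> // n; rewrite normr_gt0; move: n.
(* At a zero of [phi] the equation reduces to [nbsum phi n = 0], a sum of nonnegative terms. *)
have zero n p : phi n = 0 -> phi (n + unit_step p) = 0.
  move=> phin; have := Hphi n; rewrite /rham phin !mulr0 sub0r addr0.
  move/eqP; rewrite oppr_eq0 /nbsum => /eqP.
  have nn (j : 'I_d) : true -> 0 <= phi (n + delta j) + phi (n - delta j).
    by move=> _; rewrite addr_ge0 // normr_ge0.
  move/(psumr_eq0P nn) => /(_ p.1 isT) /eqP.
  rewrite paddr_eq0 ?normr_ge0 // => /andP[/eqP h1 /eqP h2].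
  by rewrite /unit_step; case: p.2.
move=> n; apply/negP => /eqP fn; move/negP: fn0; apply.
rewrite -normr_eq0; apply/eqP.
apply: (@lattice_ind (fun m => phi m = 0) n) => //.
by rewrite /phi fn normr0.
Qed.

End PositiveGroundState.

(** * Comparison with a subsolution *)

Section Comparison.
Variables (R : realType) (d : nat).
Local Notation Z := 'rV[int]_d.
Implicit Types (f g : Z -> R) (n m : Z) (V : Z -> R).

Lemma coord_le_enorm n j : `|(n ord0 j)%:~R| <= enorm R n.
Proof.
rewrite -ler_sqr ?nnegrE ?enorm_ge0 // enorm_sqr real_normK ?num_real //.
by rewrite (bigD1 j) //= lerDl; apply: sumr_ge0 => i _; rewrite sqr_ge0.
Qed.

Lemma enorm_step_sqr n p : enorm R (n + unit_step p) ^+ 2 =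
  enorm R n ^+ 2 + (if p.2 then 1 else - 1) * 2 * (n ord0 p.1)%:~R + 1.
Proof.
rewrite !enorm_sqr (bigD1 p.1) //= [in RHS](bigD1 p.1) //=.
rewrite mxE unit_stepE eqxx mulr1.
have -> : \sum_(i < d | i != p.1) ((n + unit_step p) ord0 i)%:~R ^+ 2 =
          \sum_(i < d | i != p.1) (n ord0 i)%:~R ^+ 2 :> R.
  by apply: eq_bigr => i /negPf ip; rewrite mxE unit_stepE ip mulr0 addr0.
by case: p.2; rewrite rmorphD ?rmorphN /=; ring.
Qed.

Lemma enorm_step n p : `|enorm R (n + unit_step p) - enorm R n| <= 1.
Proof.
have := enorm_step_sqr n p; have := coord_le_enorm n p.1.
have := enorm_ge0 R n; have := enorm_ge0 R (n + unit_step p).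
set b := enorm R (n + _); set a := enorm R n; set x := _%:~R.
move=> b0 a0; rewrite ler_norml => /andP[x1 x2] e.
have e1 : b ^+ 2 <= (a + 1) ^+ 2 by rewrite e; case: p.2; lra.
have e2 : (a - 1) ^+ 2 <= b ^+ 2 by rewrite e; case: p.2; lra.
rewrite ler_norml; apply/andP; split; first by nra.
by rewrite ler_sqr ?nnegrE ?addr_ge0 // in e1; lra.
Qed.

(** Coordinates are shifted by [M], which makes the cube of half-width [M] the image of a finite
    type of known cardinality. *)
Definition box (M : nat) (b : {ffun 'I_d -> 'I_(2 * M).+1}) : Z :=
  \row_j ((b j)%:Z - M%:Z).

Lemma boxP (M : nat) n : enorm R n <= M%:R ->
  exists b : {ffun 'I_d -> 'I_(2 * M).+1}, n = box b.
Proof.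
move=> nM; have nj j : (`|n ord0 j| <= M%:Z)%R.
  have := le_trans (coord_le_enorm n j) nM.
  by rewrite -intr_norm -[M%:R]/(M%:~R) ler_int.
exists [ffun j => inord `|n ord0 j + M%:Z|]; apply/matrixP => i j.
rewrite ord1 mxE ffunE; move: (nj j); rewrite -[n 0 j]/(n ord0 j).
by move: (n ord0 j) => z; rewrite ler_norml => /andP[h1 h2]; rewrite inordK; lia.
Qed.

Lemma card_box (M : nat) : #|{ffun 'I_d -> 'I_(2 * M).+1}| = ((2 * M).+1 ^ d)%N.
Proof. by rewrite card_ffun !card_ord. Qed.

Lemma asum_ball (M : nat) f : (forall n, f n != 0 -> enorm R n <= M%:R) -> asum f.
Proof.
by move=> supp; apply: (asum_support (e := @box M)) => n /supp; exact: boxP.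
Qed.

Lemma Sum_ball_le (M : nat) f (K : R) :
  (forall n, 0 <= f n <= K) -> (forall n, f n != 0 -> enorm R n <= M%:R) ->
  Sum f <= ((2 * M).+1 ^ d)%:R * K.
Proof.
move=> fK supp.
have := @Sum_support_le _ _ _ (@box M) f (fun n => proj1 (andP (fK n)))
  (fun n fn => boxP (supp n fn)).
move=> /le_trans; apply; rewrite -card_box mulr_natl -sumr_const.
by apply: ler_sum => i _; case/andP: (fK (box i)).
Qed.

(** The reciprocal of 1 plus the sum of all reciprocals serves as [c]; it is positive also for empty
    [I]. *)
Lemma finite_lower_bound (I : finType) (F : I -> R) : (forall i, 0 < F i) ->
  exists2 c, 0 < c & forall i, c <= F i.
Proof.
move=> F0; pose s := \sum_i (F i)^-1.
have s0 : 0 <= s by apply: sumr_ge0 => i _; rewrite invr_ge0 ltW.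
have s1 : 0 < s + 1 by rewrite ltr_wpDl.
exists (s + 1)^-1; first by rewrite invr_gt0.
move=> i; rewrite -[F i]invrK lef_pV2 ?posrE ?invr_gt0 //.
rewrite -[leLHS]addr0 lerD // /s (bigD1 i) //= lerDl.
by apply: sumr_ge0 => j _; rewrite invr_ge0 ltW.
Qed.

Definition clamp (x : R) : R := Num.max 0 (Num.min 1 x).

Lemma clampE x : clamp x = if x <= 0 then 0 else if 1 <= x then 1 else x.
Proof.
rewrite /clamp; case: (leP 1 x) => h1; case: (leP x 0) => h2.
- by lra.
- by apply/max_idPr.
- by [].
- by [].
Qed.

Lemma clamp_lip x y : (clamp x - clamp y) ^+ 2 <= (x - y) ^+ 2.
Proof.
rewrite -[leLHS]real_normK ?num_real // -[leRHS]real_normK ?num_real //.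
rewrite ler_sqr ?nnegrE // !clampE.
case: (ger0P (x - y)) => xy; rewrite ler_norml; case: (leP x 0) => h1;
  case: (leP y 0) => h2; case: (leP 1 x) => h3; case: (leP 1 y) => h4;
  by apply/andP; split; lra.
Qed.

Lemma clamp_eq1 x : 1 <= x -> clamp x = 1.
Proof. by rewrite clampE => h; rewrite h; case: leP; lra. Qed.

Lemma clamp_eq0 x : x <= 0 -> clamp x = 0.
Proof. by rewrite clampE => ->. Qed.

Definition cutoff (N : nat) n : R := clamp (2 - enorm R n / N%:R).

Lemma cutoff_lip (N : nat) n p : (0 < N)%N ->
  (cutoff N n - cutoff N (n + unit_step p)) ^+ 2 <= (N%:R ^+ 2)^-1.
Proof.
move=> N0; apply: le_trans (clamp_lip _ _) _.
have -> : 2 - enorm R n / N%:R - (2 - enorm R (n + unit_step p) / N%:R) =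
  (enorm R (n + unit_step p) - enorm R n) / N%:R by ring.
rewrite exprMn exprVn ler_piMl ?invr_ge0 ?sqr_ge0 //.
rewrite -real_normK ?num_real // -[leRHS](expr1n _ 2) ler_sqr ?nnegrE //.
exact: enorm_step.
Qed.

Lemma cutoff_neq0 (N : nat) n : (0 < N)%N -> cutoff N n != 0 -> enorm R n <= (2 * N)%:R.
Proof.
move=> N0; apply: contra_neqT; rewrite -ltNge => nN; apply: clamp_eq0.
by rewrite subr_le0 ler_pdivlMr ?ltr0n // -natrM ltW.
Qed.

Lemma cutoff_eq1 (N : nat) n : (0 < N)%N -> enorm R n <= N%:R -> cutoff N n = 1.
Proof.
move=> N0 nN; apply: clamp_eq1.
have : enorm R n / N%:R <= 1 by rewrite ler_pdivrMr ?ltr0n // mul1r.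
by lra.
Qed.

Lemma weighted_sq_ge0 (a b x : R) : 0 < a -> 0 < b -> 0 <= a * b * x ^+ 2.
Proof. by move=> a0 b0; apply: mulr_ge0; rewrite ?sqr_ge0 // mulr_ge0 // ltW. Qed.

(* The weight [u u'] is recurrent: its Dirichlet energy of the linear cutoffs
   vanishes in the limit. *)
Lemma cutoff_energy (u : Z -> R) (r : R) (j : 'I_d) (N : nat) :
  (forall n, 0 < u n) ->
  (forall n, r <= enorm R n -> u n ^+ 2 * enorm R n ^+ d <= 1) ->
  r + 1 <= N%:R -> (1 < N)%N ->
  Sum (fun n => u n * u (n + delta j) *
    (cutoff N n - cutoff N (n + delta j)) ^+ 2) <= 11 ^+ d / N%:R ^+ 2.
Proof.
move=> u0 udec rN N1; have N0 : (0 < N)%N by exact: ltnW.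
have NR : 1 < N%:R :> R by rewrite ltr1n.
set f := fun n => _.
have step n : `|enorm R (n + delta j) - enorm R n| <= 1.
  exact: (enorm_step n (j, true)).
(* If both ends of the edge lie in the ball of radius [N], both cutoffs are 1; if one lies outside,
   the other has norm at least [N - 1]. *)
have supp n : f n != 0 -> N%:R - 1 <= enorm R n <= (2 * N).+1%:R /\
    N%:R - 1 <= enorm R (n + delta j).
  have := step n; rewrite ler_norml => /andP[s1 s2] fn0.
  have ab : cutoff N n != cutoff N (n + delta j).
    by apply: contra_neq fn0 => ab; rewrite /f ab subrr expr0n mulr0.
  have lo : N%:R - 1 <= enorm R n /\ N%:R - 1 <= enorm R (n + delta j).
    have [lt1|] := ltP N%:R (enorm R n); first by split; lra.
    have [lt2|] := ltP N%:R (enorm R (n + delta j)); first by split; lra.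
    move=> h1 h2; move: ab; rewrite !cutoff_eq1 //; first by rewrite eqxx.
  split; last exact: lo.2.
  rewrite lo.1 /= -natr1; have [c0|c0] := eqVneq (cutoff N n) 0.
    have : cutoff N (n + delta j) != 0 by rewrite -c0 eq_sym.
    by move/(cutoff_neq0 N0); lra.
  by move/(cutoff_neq0 N0): c0; lra.
have key n : 0 <= f n <= ((N%:R - 1) ^+ d)^-1 / N%:R ^+ 2.
  apply/andP; split; first exact: weighted_sq_ge0.
  have pos : 0 < ((N%:R - 1) ^+ d)^-1 :> R.
    by rewrite invr_gt0 exprn_gt0 // subr_gt0.
  have [->|fn0] := eqVneq (f n) 0.
    by rewrite mulr_ge0 ?invr_ge0 ?sqr_ge0 // ltW // -invr_gt0.
  have [/andP[l1 _] l2] := supp n fn0.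
  apply: ler_pM; rewrite ?sqr_ge0 //.
  - by rewrite mulr_ge0 ?ltW.
  - have dec m : N%:R - 1 <= enorm R m -> u m ^+ 2 <= ((N%:R - 1) ^+ d)^-1.
      move=> lm; rewrite -[leRHS]mul1r ler_pdivlMr ?exprn_gt0 ?subr_gt0 //.
      have : u m ^+ 2 * enorm R m ^+ d <= 1 by apply: udec; lra.
      apply: le_trans; rewrite ler_wpM2l ?sqr_ge0 // lerXn2r ?nnegrE ?enorm_ge0 //.
      by lra.
    have := dec _ l1; have := dec _ l2; set x := u n; set y := u (n + _).
    by have := sqr_ge0 (x - y); lra.
  - exact: (cutoff_lip n (j, true) N0).
have suppM n : f n != 0 -> enorm R n <= (2 * N).+1%:R.
  by move=> /supp [/andP[]].
apply: le_trans (Sum_ball_le key suppM) _.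
rewrite mulrA ler_wpM2r ?invr_ge0 ?sqr_ge0 // natrX -exprVn -exprMn.
have N1i : 0 <= (N%:R - 1)^-1 :> R by rewrite invr_ge0 subr_ge0 ltW.
apply: lerXn2r; rewrite ?nnegrE ?mulr_ge0 // ler_pdivrMr ?subr_gt0 //.
(* Source of the constant 11: [4 N + 3 <= 11 (N - 1)] as soon as [N >= 2]. *)
have N2 : 2 <= N%:R :> R by rewrite ler_nat.
have -> : (2 * (2 * N).+1).+1 = (4 * N + 3)%N by lia.
rewrite natrD natrM.
by lra.
Qed.

(** If both truncations are active, [g - g' = y - x] and equality holds. If only one is, replacing
    [c] by the larger of [x] and [y] moves the first factor in the direction of the sign of the
    second. *)
Lemma truncation_ineq (c x y a b : R) : 0 <= a -> 0 <= b ->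
  let g := Num.max (c - x) 0 in let g' := Num.max (c - y) 0 in
  (g - g') * (g * a - g' * b) <= (y - x) * (g * a - g' * b).
Proof.
move=> a0 b0 /=; case: (lerP (c - x) 0) => h1; case: (lerP (c - y) 0) => h2.
- by rewrite !mul0r subrr !mulr0.
- have : 0 <= (x - c) * ((c - y) * b) by rewrite !mulr_ge0 //; lra.
  by lra.
- have : 0 <= (y - c) * ((c - x) * a) by rewrite !mulr_ge0 //; lra.
  by lra.
- by lra.
Qed.

(** Ground state transform: for [v = phi / u], the equation for [phi] and the inequality for [u]
    make [v] superharmonic with respect to the edge weights [u(n) u(m)] where the norm is at least
    [r]. *)
Lemma supersolution_lower_bound V (phi u : Z -> R) (r : R) :
  (forall n, 0 < phi n) -> (forall n, rham V phi n = 0) ->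
  (forall n, 0 < u n) ->
  (forall n, r <= enorm R n -> V n * u n <= nbsum u n - 2 * d%:R * u n) ->
  (forall n, r <= enorm R n -> u n ^+ 2 * enorm R n ^+ d <= 1) ->
  exists2 c, 0 < c & forall n, c * u n <= phi n.
Proof.
move=> phi0 Hphi u0 Hu udec.
pose v n := phi n / u n.
have v0 n : 0 < v n by rewrite divr_gt0.
have phiE n : phi n = u n * v n by rewrite /v mulrC divfK // gt_eqF.
pose M := (Num.trunc `|r|).+1.
have rM : r <= M%:R by rewrite (le_trans (ler_norm r)) // ltW // truncnS_gt.
have [c c0 cv] := finite_lower_bound (fun i => v0 (@box M i)).
exists c => //.
have {}cv n : enorm R n <= M%:R -> c <= v n by move=> /boxP [b ->].
pose g n := Num.max (c - v n) 0.
have g_ge0 n : 0 <= g n by exact: max0_ge0.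
have g_le n : g n <= c by rewrite ge_max gerBl !ltW.
have super n : g n * (\sum_(j < d) (u (n + delta j) * (v (n + delta j) - v n) +
    u (n - delta j) * (v (n - delta j) - v n))) <= 0.
  have [gn|gn] := eqVneq (g n) 0; first by rewrite gn mul0r.
  rewrite mulr_ge0_le0 //.
  have rn : r <= enorm R n.
    apply: le_trans rM _; rewrite leNgt; apply: contra_neqN gn => /ltW /cv cvn.
    by apply/max_idPr; rewrite subr_le0.
  have := Hphi n; rewrite /rham phiE.
  have -> : nbsum phi n = nbsum (fun m => u m * v m) n.
    by congr nbsum; apply/funext => m.
  have := ler_wpM2r (ltW (v0 n)) (Hu n rn).
  have -> : \sum_(j < d) (u (n + delta j) * (v (n + delta j) - v n) +
    u (n - delta j) * (v (n - delta j) - v n)) =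
    nbsum (fun m => u m * v m) n - v n * nbsum u n.
    rewrite /nbsum mulr_sumr -sumrB; apply: eq_bigr => j _; ring.
  by lra.
have const n p : g (n + unit_step p) = g n.
  wlog pE : n p / p = (p.1, true).
    move=> W; case: p => j [|]; first exact: W.
    rewrite -(W (n + unit_step (j, false)) (j, true)) //.
    by rewrite /unit_step /= subrK.
  rewrite pE /unit_step /=; move: p.1 => {p pE} j.
  set n' := n + delta j.
  have uu0 : 0 < u n * u n' by rewrite mulr_gt0.
  pose C := c ^+ 2 * (d%:R * 11 ^+ d).
  have C0 : 0 <= C by apply: mulr_ge0; rewrite ?sqr_ge0 // mulr_ge0 // exprn_ge0.
  (* The test function is [u g ch^2]. The energy of [g ch] over all edges is at most [c^2] times
     that of [ch], and the fixed edge is one of its terms. *)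
  have bound (N : nat) : r + 1 <= N%:R -> (1 < N)%N -> enorm R n <= N%:R ->
      enorm R n' <= N%:R -> u n * u n' * (g n - g n') ^+ 2 <= C / N%:R ^+ 2.
    move=> rN N1 nN n'N; have N0 : (0 < N)%N by exact: ltnW.
    pose ch := cutoff N; pose k m := g m * ch m ^+ 2.
    pose X (i : 'I_d) m := u m * u (m + delta i) * (v (m + delta i) - v m) * k m.
    pose Y (i : 'I_d) m := u m * u (m - delta i) * (v (m - delta i) - v m) * k m.
    pose P (i : 'I_d) m := u m * u (m + delta i) *
      (g m * ch m - g (m + delta i) * ch (m + delta i)) ^+ 2.
    pose Q (i : 'I_d) m := u m * u (m + delta i) *
      (ch m - ch (m + delta i)) ^+ 2.
    have ksupp m : k m != 0 -> enorm R m <= (2 * N)%:R.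
      rewrite mulf_eq0 negb_or expf_eq0 /= => /andP[_].
      exact: cutoff_neq0.
    have sX i : asum (X i).
      apply: (@asum_ball (2 * N)) => m; rewrite mulf_eq0 negb_or => /andP[_].
      exact: ksupp.
    have sY i : asum (Y i).
      apply: (@asum_ball (2 * N)) => m; rewrite mulf_eq0 negb_or => /andP[_].
      exact: ksupp.
    have sPQ (F : 'I_d -> Z -> R) : (forall i m, ch m = 0 -> ch (m + delta i) = 0 ->
        F i m = 0) -> forall i, asum (F i).
      move=> F0 i; apply: (@asum_ball (2 * N).+1) => m Fm.
      have := enorm_step m (i, true); rewrite ler_norml /unit_step /= => /andP[s1 s2].
      rewrite -natr1; have [ch0|/(cutoff_neq0 N0)] := eqVneq (ch m) 0; last by lra.
      have /(cutoff_neq0 N0) : ch (m + delta i) != 0.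
        by apply: contra_neq Fm; exact: F0.
      by lra.
    have sP i : asum (P i).
      by apply: sPQ => {}i m e1 e2; rewrite /P e1 e2 !mulr0 subrr expr0n mulr0.
    have sQ i : asum (Q i).
      by apply: sPQ => {}i m e1 e2; rewrite /Q e1 e2 subrr expr0n mulr0.
    have P0 i m : 0 <= P i m by exact: weighted_sq_ge0.
    have Q0 i m : 0 <= Q i m by exact: weighted_sq_ge0.
    have neg : \sum_(i < d) (Sum (X i) + Sum (Y i)) <= 0.
      under eq_bigr do rewrite -SumD //.
      rewrite -Sum_sum => [|i]; last exact: asumD.
      rewrite -oppr_ge0 -SumN; apply: Sum_ge0 => [|m].
        by apply: asumN; apply: asum_sum => i; apply: asumD.
      rewrite oppr_ge0.
      have -> : \sum_(i < d) (X i m + Y i m) = u m * ch m ^+ 2 * (g m *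
        \sum_(i < d) (u (m + delta i) * (v (m + delta i) - v m) +
        u (m - delta i) * (v (m - delta i) - v m))).
        by rewrite !mulr_sumr; apply: eq_bigr => i _; rewrite /X /Y /k; ring.
      by rewrite mulr_ge0_le0 // mulr_ge0 ?sqr_ge0 ?ltW.
    have PQ : \sum_(i < d) Sum (P i) <= \sum_(i < d) c ^+ 2 * Sum (Q i).
      rewrite -subr_ge0 -sumrB; apply: le_trans (_ : 0 <= - _) _.
        by rewrite oppr_ge0; exact: neg.
      rewrite -sumrN; apply: ler_sum => i _.
      (* Summation by parts: shifting [Y i] joins the two contributions of each edge into
         [u u' (v' - v) (k - k')]. *)
      rewrite -SumZ // -(Sum_comp (Y i) (@shiftK d (delta i)) (@shiftKV d (delta i))).
      have sY' := asum_comp (@shiftK d (delta i)) (@shiftKV d (delta i)) (sY i).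
      have sZ := asumZ (c ^+ 2) (sQ i).
      rewrite -SumD // -SumN -SumB //; apply: le_Sum.
      - by apply: asumN; apply: asumD.
      - exact: asumB.
      move=> m; rewrite /X /Y /P /Q /k addrK; set m' := m + delta i.
      have w0 : 0 <= u m * u m' by rewrite mulr_ge0 ?ltW.
      (* Rests on [(g ch - g' ch')^2 = (g - g') (g ch^2 - g' ch'^2) + g g' (ch - ch')^2] and on
         [g, g' <= c]. *)
      have key : (g m * ch m - g m' * ch m') ^+ 2 <=
          c ^+ 2 * (ch m - ch m') ^+ 2 +
          (v m' - v m) * (g m * ch m ^+ 2 - g m' * ch m' ^+ 2).
        have gg : g m * g m' * (ch m - ch m') ^+ 2 <= c ^+ 2 * (ch m - ch m') ^+ 2.
          by rewrite ler_wpM2r ?sqr_ge0 // expr2 ler_pM.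
        have s1 := sqr_ge0 (ch m); have s2 := sqr_ge0 (ch m').
        suff : (g m - g m') * (g m * ch m ^+ 2 - g m' * ch m' ^+ 2) <=
           (v m' - v m) * (g m * ch m ^+ 2 - g m' * ch m' ^+ 2) by lra.
        exact: truncation_ineq.
      have := ler_wpM2l w0 key; rewrite [u m' * u m]mulrC.
      by lra.
    have -> : u n * u n' * (g n - g n') ^+ 2 = P j n.
      by rewrite /P /ch !cutoff_eq1 // !mulr1.
    apply: le_trans (Sum_ge_term n (sP j) (P0 j)) _.
    apply: (@le_trans _ _ (\sum_(i < d) Sum (P i))).
      rewrite (bigD1 j) //= lerDl; apply: sumr_ge0 => i _.
      by apply: Sum_ge0.
    apply: le_trans PQ _; rewrite -mulr_sumr.
    have -> : C / N%:R ^+ 2 = c ^+ 2 * (d%:R * (11 ^+ d / N%:R ^+ 2)).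
      by rewrite /C; ring.
    rewrite ler_pM2l ?exprn_gt0 //.
    rewrite mulr_natl -[X in _ *+ X]card_ord -sumr_const; apply: ler_sum => i _.
    exact: (@cutoff_energy _ r).
  apply/eqP; rewrite eq_sym -subr_eq0 -sqrf_eq0 eq_le sqr_ge0 andbT leNgt.
  apply/negP => gg; pose e := u n * u n' * (g n - g n') ^+ 2.
  have e0 : 0 < e by rewrite mulr_gt0.
  (* Any [N > B] meets the conditions of [bound] and satisfies [C < e N <= e N^2]. *)
  pose B := `|r| + 2 + enorm R n + enorm R n' + C / e.
  have Ce : 0 <= C / e by rewrite divr_ge0 // ltW.
  have := enorm_ge0 R n; have := enorm_ge0 R n'; have := ler_norm r.
  have := normr_ge0 r => r1 r2 en' en.
  pose N := (Num.trunc B).+1; have BN : B < N%:R by rewrite truncnS_gt.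
  have N1 : 1 < N%:R :> R by rewrite /B in BN; lra.
  have := bound N; rewrite -/e -(@ltr_nat R) N1 => /(_ _ isT).
  rewrite ler_pdivlMr; last by rewrite exprn_gt0 //; lra.
  have -> : r + 1 <= N%:R by rewrite /B in BN; lra.
  have -> : enorm R n <= N%:R by rewrite /B in BN; lra.
  have -> : enorm R n' <= N%:R by rewrite /B in BN; lra.
  move=> /(_ isT isT isT); rewrite leNgt => /negP; apply.
  have CN : C < e * N%:R.
    by rewrite mulrC -ltr_pdivrMr //; rewrite /B in BN; lra.
  apply: lt_le_trans CN _; rewrite ler_pM2l // expr2.
  by rewrite ler_peMl //; lra.
have g0 : g 0 = 0.
  apply/max_idPr; rewrite subr_le0; apply: cv.
  by rewrite /enorm big1 ?sqrtr0 // => j _; rewrite mxE expr0n.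
move=> n; have : g n = 0.
  apply: (@lattice_ind _ (fun m => g m = 0) 0 g0) => m p gm.
  by rewrite const.
move/max_idPr; rewrite subr_le0 /v ler_pdivlMr //.
Qed.

End Comparison.

(** * Iterated logarithms *)

Arguments iterlog : simpl never.

Section IteratedLogarithms.
Variable R : realType.
Implicit Types x y r : R.

(** In this range every logarithm up to index [s + 1] has a positive argument. The threshold 1,
    rather than 0, bounds the reciprocals by 1. *)
Definition large (s : nat) r : Prop := forall i, (i <= s)%N -> 1 <= iterlog i r.

Lemma iterlogS k x : iterlog k.+1 x = ln (iterlog k x).
Proof. by []. Qed.

Lemma iterlog_cvg (k : nat) (A : R) :
  exists r0 : R, forall r, r0 <= r -> A <= iterlog k r.
Proof.
elim: k A => [|k IH] A; first by exists A.
have [r0 Hr0] := IH (expR A); exists r0 => r /Hr0 Ar.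
by rewrite iterlogS -[A]expRK ler_ln ?posrE ?expR_gt0 // (lt_le_trans _ Ar) ?expR_gt0.
Qed.

Lemma eventually_large (s : nat) :
  exists2 r0 : R, 1 <= r0 & forall r, r0 <= r -> large s r.
Proof.
elim: s => [|s [r0 r01 IH]]; first by exists 1 => // r r1 [].
have [r1 Hr1] := iterlog_cvg s.+1 1.
exists (Num.max r0 r1); first by rewrite le_max r01.
move=> r; rewrite ge_max => /andP[h0 h1] i; rewrite leq_eqVlt => /orP[/eqP ->|].
  exact: Hr1.
by rewrite ltnS; exact: IH.
Qed.

Lemma large_gt0 s i r : large s r -> (i <= s)%N -> 0 < iterlog i r.
Proof. by move=> ls /ls; exact: lt_le_trans. Qed.

Lemma iterlog_le s k x y : large s x -> x <= y -> (k <= s.+1)%N ->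
  iterlog k x <= iterlog k y.
Proof.
move=> lx xy; elim: k => [//|k IH] ks; rewrite !iterlogS.
have xk := large_gt0 lx ks; have := IH (ltnW ks) => le_k.
by rewrite ler_ln // posrE // (lt_le_trans xk).
Qed.

Lemma large_le s x y : large s x -> x <= y -> large s y.
Proof.
move=> lx xy i is_; apply: le_trans (lx i is_) _.
exact: iterlog_le lx xy (leqW is_).
Qed.

Lemma ln_increment x y : 0 < x -> 0 < y -> ln y - ln x <= (y - x) / x.
Proof.
move=> x0 y0; rewrite -ln_div // -[X in ln X](subrKC 1).
apply: le_trans (le_ln1Dx _) _.
  by rewrite ltrBrDr addNr divr_gt0.
by rewrite mulrBl divff ?gt_eqF.
Qed.

(** The bound [ln y - ln x <= (y - x) / x], iterated. It turns increments of [log_(s+1)] into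
    telescoping lower bounds for the series of [1 / (x log_1 x ... log_s x)]. *)
Lemma iterlog_increment s x y : large s x -> x <= y ->
  iterlog s.+1 y - iterlog s.+1 x <= (y - x) * \prod_(0 <= i < s.+1) (iterlog i x)^-1.
Proof.
move=> lx xy; have ly := large_le lx xy.
have key k : (k <= s.+1)%N ->
    iterlog k y - iterlog k x <= (y - x) * \prod_(0 <= i < k) (iterlog i x)^-1.
  elim: k => [|k IH] ks; first by rewrite big_nil mulr1.
  have xk := large_gt0 lx ks; have yk := large_gt0 ly ks.
  rewrite big_nat_recr //= mulrA !iterlogS.
  apply: le_trans (ln_increment xk yk) _.
  by apply: ler_wpM2r (IH (ltnW ks)); rewrite invr_ge0 ltW.
exact: key.
Qed.

Variables (d : nat) (s : nat).

(** Minus the logarithm of the profile: quotients become differences, and the derivative becomes a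
    sum. *)
Definition phase r : R :=
  d%:R / 2 * iterlog 1 r + 2^-1 * \sum_(1 <= i < s.+1) iterlog i.+1 r.

(* [profile r] is r^(-d/2) (log_1 r ... log_s r)^(-1/2). *)
Definition profile r : R := expR (- phase r).

Lemma profile_gt0 r : 0 < profile r.
Proof. exact: expR_gt0. Qed.

(** Recognises each summand of the first criterion as a quotient [u(m) / u(n)], so that the
    criterion is the subsolution inequality for [u]. *)
Lemma profile_ratio x y : large s x -> large s y ->
  (x / y) `^ (d%:R / 2) *
    \prod_(1 <= i < s.+1) Num.sqrt (iterlog i x / iterlog i y) =
  profile y / profile x.
Proof.
move=> lx ly; have x0 := large_gt0 lx (leq0n s); have y0 := large_gt0 ly (leq0n s).
have powE a b p : 0 < a -> 0 < b -> (a / b) `^ p = expR (p * (ln a - ln b)).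
  by move=> a0 b0; rewrite /powR gt_eqF ?divr_gt0 // ln_div ?posrE.
rewrite powE // (eq_big_nat _ _ (F2 := fun i =>
    expR (2^-1 * (iterlog i.+1 x - iterlog i.+1 y)))); last first.
  move=> i /andP[_ is_]; have xi := large_gt0 lx is_; have yi := large_gt0 ly is_.
  by rewrite -powR12_sqrt ?powE // ltW // divr_gt0.
rewrite -expR_sum -expRD -expRB /phase; congr expR.
by rewrite -mulr_sumr sumrB !iterlogS /=; ring.
Qed.

Lemma profile_sqr r : large s r ->
  profile r ^+ 2 = (r ^+ d)^-1 * \prod_(1 <= i < s.+1) (iterlog i r)^-1.
Proof.
move=> lr; have r0 := large_gt0 lr (leq0n s).
rewrite -expRM_natl /phase.
have -> : 2%:R * - (d%:R / 2 * iterlog 1 r +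
      2^-1 * \sum_(1 <= i < s.+1) iterlog i.+1 r) =
    - (d%:R * ln r) + \sum_(1 <= i < s.+1) - iterlog i.+1 r.
  by rewrite sumrN !iterlogS /=; field.
rewrite expRD expRN expRM_natl lnK ?posrE // expR_sum; congr (_ * _).
apply: eq_big_nat => i /andP[_ is_].
by rewrite expRN iterlogS lnK // posrE (large_gt0 lr).
Qed.

Lemma profile_decay r : large s r -> profile r ^+ 2 * r ^+ d <= 1.
Proof.
move=> lr; have r0 := large_gt0 lr (leq0n s).
rewrite profile_sqr // mulrAC mulVf ?mul1r ?expf_neq0 ?gt_eqF //.
rewrite big_nat; apply: prodr_ile1 => i /andP[_ is_].
have li := lr i is_; have i0 := large_gt0 lr is_.
by rewrite invr_ge0 ltW //= invf_le1.
Qed.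

Lemma profile_le x y : large s x -> x <= y -> profile y <= profile x.
Proof.
move=> lx xy; rewrite ler_expR lerN2 lerD //.
  by rewrite ler_wpM2l ?divr_ge0 // (iterlog_le lx).
rewrite ler_pM2l ?invr_gt0 //; apply: ler_sum_nat => i /andP[_ is_].
exact: iterlog_le lx xy is_.
Qed.

End IteratedLogarithms.

(** * Divergence of the square sum of the profile *)

Section NotSquareSummable.
Variables (R : realType) (d' : nat) (s : nat).
Local Notation d := d'.+1.
Local Notation Z := 'rV[int]_d.

(** Restricted to later coordinates below the first one [k], these are [k^(d-1)] points of norm
    between [k] and [d k], which replaces a count of points in spherical shells. *)
Definition cone_point (K : nat) (p : 'I_K * {ffun 'I_d' -> 'I_K}) : Z :=
  \row_j (if unlift ord0 j is Some i then (p.2 i : nat)%:Z else (p.1 : nat)%:Z).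

Lemma cone_point0 K (p : 'I_K * {ffun 'I_d' -> 'I_K}) :
  cone_point p ord0 ord0 = (p.1 : nat)%:Z.
Proof. by rewrite mxE unlift_none. Qed.

Lemma cone_pointS K (p : 'I_K * {ffun 'I_d' -> 'I_K}) i :
  cone_point p ord0 (lift ord0 i) = (p.2 i : nat)%:Z.
Proof. by rewrite mxE liftK. Qed.

Lemma cone_point_inj K : injective (@cone_point K).
Proof.
move=> [k a] [l b] /matrixP E; congr pair.
  have := E ord0 ord0; rewrite !cone_point0 /= => -[] kl.
  exact: val_inj.
apply/ffunP => i; have := E ord0 (lift ord0 i); rewrite !cone_pointS /= => -[] ab.
exact: val_inj.
Qed.

Lemma cone_point_enorm K (p : 'I_K * {ffun 'I_d' -> 'I_K}) :
  (forall i, (p.2 i < p.1)%N) ->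
  (p.1 : nat)%:R <= enorm R (cone_point p) <= d%:R * (p.1 : nat)%:R.
Proof.
move=> ap; apply/andP; split.
  have := coord_le_enorm R (cone_point p) ord0.
  by rewrite cone_point0 ger0_norm ?ler0z.
have dk0 : 0 <= d%:R * (p.1 : nat)%:R :> R by rewrite mulr_ge0.
rewrite -ler_sqr ?nnegrE ?enorm_ge0 // enorm_sqr exprMn.
apply: (@le_trans _ _ (\sum_(j < d) (p.1 : nat)%:R ^+ 2)).
  apply: ler_sum => j _; rewrite lerXn2r ?nnegrE //.
    rewrite mxE; case: (unlift ord0 j) => [i|]; exact: ler0n.
  rewrite mxE; case: (unlift ord0 j) => [i|] //; rewrite ler_nat.
  by rewrite ltnW // ap.
rewrite sumr_const card_ord -[leLHS]mulr_natl ler_wpM2r ?sqr_ge0 //.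
by rewrite -natrX ler_nat expnS expn1 leq_pmulr.
Qed.

(** The points of the cone with first coordinate [k] contribute at least [k^(d-1) profile(d k)^2 =
    d^-d / (k log_1(d k) ... log_s(d k))]. This dominates [d^-d] times the increment of [log_(s+1)]
    from [d k] to [d (k + 1)], and the increments telescope to infinity. *)
Lemma profile_not_sqsum :
  ~ sqsum (fun n : Z => profile d s (enorm R n)).
Proof.
move=> su; pose u (n : Z) := profile d s (enorm R n).
have [r0 r01 Hr0] := eventually_large R s.
pose k0 := (Num.trunc r0).+1.
have k0r : r0 <= k0%:R by rewrite ltW // truncnS_gt.
pose x (k : nat) : R := d%:R * k%:R.
have xk0 (k : nat) : (k0 <= k)%N -> r0 <= x k /\ 0 < k%:R :> R.
  rewrite -(ler_nat R) => kk; have k1 : 0 < k%:R :> R by lra.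
  split=> //; apply: le_trans k0r _; apply: le_trans kk _.
  by rewrite /x ler_peMl ?ler1n // ltW.
pose L := @iterlog R s.+1.
have bound (K : nat) : (k0 <= K)%N ->
    ((d%:R ^+ d)^-1) * (L (x K) - L (x k0)) <= Sum (fun n => u n ^+ 2).
  move=> kK; pose Q (k : 'I_K) (a : {ffun 'I_d' -> 'I_K}) :=
    a \in ffun_on [pred i : 'I_K | (i < k)%N].
  apply: le_trans (_ : _ <= \sum_(p : 'I_K * {ffun 'I_d' -> 'I_K} |
      (k0 <= p.1)%N && Q p.1 p.2) u (cone_point p) ^+ 2) _; last first.
    apply: (@sum_inj_le_Sum _ _ _ _ (@cone_point K) (fun n => u n ^+ 2)) => //.
      by move=> p q _ _; exact: cone_point_inj.
    by move=> n; rewrite sqr_ge0.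
  rewrite -(pair_big_dep (fun k : 'I_K => (k0 <= k)%N) Q
    (fun k a => u (cone_point (k, a)) ^+ 2)) /=.
  rewrite -(telescope_sumr (fun k => L (x k)) kK) mulr_sumr big_geq_mkord /=.
  apply: ler_sum => k kk; have [xr k1] := xk0 k kk.
  have lx := Hr0 _ xr; have x0 : 0 < x k by rewrite /x mulr_gt0.
  have term a : Q k a -> profile d s (x k) ^+ 2 <= u (cone_point (k, a)) ^+ 2.
    move/ffun_onP => ak; rewrite lerXn2r ?nnegrE ?(ltW (profile_gt0 _ _ _)) //.
    have /andP[n1 n2] := @cone_point_enorm K (k, a) ak.
    apply: profile_le => //; apply: Hr0.
    by apply: le_trans k0r _; apply: le_trans n1; rewrite ler_nat.
  apply: le_trans (_ : _ <= \sum_(a | Q k a) profile d s (x k) ^+ 2) _; last first.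
    exact: ler_sum.
  rewrite sumr_const card_ffun_on card_ord.
  have -> : #|[pred i : 'I_K | (i < k)%N]| = k.
    by rewrite -sum1_card (big_ord_narrow (ltnW (ltn_ord k))) sum1_card card_ord.
  rewrite -[leRHS]mulr_natr natrX profile_sqr //.
  have := iterlog_increment lx (_ : x k <= x k.+1).
  have -> : x k.+1 - x k = d%:R by rewrite /x -natr1; ring.
  rewrite big_nat_recl //= -/(L _) -/(L _); set G := \prod_(0 <= i < s) _.
  have -> : \prod_(1 <= i < s.+1) (iterlog i (x k))^-1 = G by rewrite big_add1.
  move=> /(_ _) inc; rewrite ler_pdivrMl ?exprn_gt0 //.
  apply: le_trans (inc _) _; first by rewrite /x ler_pM2l // ler_nat.
  have -> : iterlog 0 (x k) = x k by [].
  rewrite le_eqVlt; apply/orP; left; apply/eqP.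
  rewrite /x exprMn !exprS; field.
  by rewrite !expf_neq0 ?gt_eqF.
have [r1 Hr1] := iterlog_cvg s.+1
  (L (x k0) + d%:R ^+ d * (Sum (fun n => u n ^+ 2) + 1)).
pose K := maxn k0 (Num.trunc `|r1|).+1.
have xK : r1 <= x K.
  apply: le_trans (ler_norm r1) _; apply: le_trans (ltW (truncnS_gt _)) _.
  apply: (@le_trans _ _ K%:R); first by rewrite ler_nat leq_maxr.
  by rewrite /x ler_peMl ?ler1n.
have := bound K (leq_maxl _ _); rewrite ler_pdivrMl ?exprn_gt0 //.
have := Hr1 _ xK; rewrite -/(L _) => h1 h2.
have dd : 0 < d%:R ^+ d :> R by rewrite exprn_gt0.
set S := Sum _ in h1 h2; by nra.
Qed.

End NotSquareSummable.

(** * Taylor estimates *)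

Section Derivatives.
Variable R : realType.
Implicit Types (f g : R -> R) (x a b c h : R).
Local Notation der f x a := (is_derive x (1 : R) f a).

Lemma der_add f g x a b :
  der f x a -> der g x b -> der (fun t => f t + g t) x (a + b).
Proof. exact: is_deriveD. Qed.

Lemma der_mul f g x a b :
  der f x a -> der g x b -> der (fun t => f t * g t) x (a * g x + f x * b).
Proof.
move=> fa gb; apply: is_derive_eq (is_deriveM fa gb) _.
by rewrite addrC [_ *: a]mulrC.
Qed.

Lemma der_opp f x a : der f x a -> der (fun t => - f t) x (- a).
Proof. exact: is_deriveN. Qed.

Lemma der_cst c x : der (fun _ : R => c) x 0.
Proof. exact: is_derive_cst. Qed.

Lemma der_id x : der (fun t : R => t) x 1.
Proof. exact: is_derive_id. Qed.

Lemma der_scale c f x a : der f x a -> der (fun t => c * f t) x (c * a).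
Proof.
move=> fa; apply: is_derive_eq (der_mul (der_cst c x) fa) _.
by rewrite mul0r add0r.
Qed.

Lemma der_linear c x : der (fun t : R => c * t) x (c * 1).
Proof. exact: der_scale (der_id x). Qed.

Lemma der_inv f x a : f x != 0 -> der f x a ->
  der (fun t => (f t)^-1) x (- (a * (f x)^-1 * (f x)^-1)).
Proof.
move=> fx fa; apply: is_derive_eq (is_deriveV fx fa) _.
by rewrite -mulrA -expr2 exprVn mulrC -mulNr.
Qed.

Lemma der_ln f x a : 0 < f x -> der f x a -> der (fun t => ln (f t)) x (a * (f x)^-1).
Proof.
move=> fx fa; have fl := is_derive1_ln fx.
by apply: is_derive_eq (is_derive1_comp fl fa) _; rewrite mulrC.
Qed.

Lemma der_exp f x a : der f x a -> der (fun t => expR (f t)) x (expR (f x) * a).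
Proof. by move=> fa; exact: is_derive1_comp (is_derive_expR (f x)) fa. Qed.

Lemma der_shift c f x a : der f (c + x) a -> der (fun t => f (c + t)) x a.
Proof.
move=> fa; have sh : der (fun t => c + t) x 1.
  by apply: is_derive_eq (der_add (der_cst c x) (der_id x)) _; rewrite add0r.
by apply: is_derive_eq (is_derive1_comp fa sh) _; rewrite mulr1.
Qed.

Lemma der_refl c f x a : der f (c - x) a -> der (fun t => f (c - t)) x (- a).
Proof.
move=> fa; have sh : der (fun t => c - t) x (- 1).
  by apply: is_derive_eq (der_add (der_cst c x) (der_opp (der_id x))) _; rewrite add0r.
by apply: is_derive_eq (@is_derive1_comp R f (fun t => c - t) x a (- 1) fa sh) _;
  rewrite mulrN1.
Qed.

Lemma der_sum (I : eqType) (r : seq I) (F : I -> R -> R) (A : I -> R) x :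
  (forall i, i \in r -> der (F i) x (A i)) ->
  der (fun t => \sum_(i <- r) F i t) x (\sum_(i <- r) A i).
Proof.
elim: r => [|i r IH] dF.
  rewrite big_nil (_ : (fun _ => _) = fun=> 0); first exact: der_cst.
  by apply/funext => t; rewrite big_nil.
rewrite big_cons (_ : (fun _ => _) = fun t => F i t + \sum_(j <- r) F j t).
  apply: der_add; first by apply: dF; rewrite mem_head.
  by apply: IH => j jr; apply: dF; rewrite in_cons jr orbT.
by apply/funext => t; rewrite big_cons.
Qed.

Lemma der_ge0_le f g a b : a <= b ->
  (forall x, a <= x <= b -> der f x (g x)) ->
  (forall x, a <= x <= b -> 0 <= g x) -> f a <= f b.
Proof.
move=> ab df g0.
have [||c] := @MVT_segment R f g a b ab.
- by move=> z /[!in_itv] /= /andP[/ltW az /ltW zb]; apply: df; rewrite az.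
- apply: derivable_within_continuous => z /[!in_itv] /= zab.
  by have [] := df z zab.
rewrite in_itv /= => /g0 gc fab; rewrite -subr_ge0 fab.
by rewrite mulr_ge0 // subr_ge0.
Qed.

Section Taylor.
Variables (F0 F1 F2 F3 F4 : R -> R) (lo hi : R).
Hypothesis D0 : forall x, lo <= x <= hi -> der F0 x (- F1 x).
Hypothesis D1 : forall x, lo <= x <= hi -> der F1 x (- F2 x).
Hypothesis D2 : forall x, lo <= x <= hi -> der F2 x (- F3 x).
Hypothesis D3 : forall x, lo <= x <= hi -> der F3 x (- F4 x).

(** The signs alternate, [Fk] being [(-1)^k] times the [k]-th derivative of [F0], as suits
    completely monotone functions; [F2 >= 0] is convexity. *)
Lemma tangent_below c h : lo <= c -> 0 <= h -> c + h <= hi ->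
  (forall x, lo <= x <= hi -> 0 <= F2 x) -> F0 c - h * F1 c <= F0 (c + h).
Proof.
move=> lc h0 hc F2_ge0.
have anti x : 0 <= x <= h -> F1 (c + x) <= F1 c.
  move=> /andP[x0 xh]; rewrite -lerN2.
  apply: (der_ge0_le (f := fun t => - F1 t) (g := F2)); first by lra.
    move=> t /andP[t1 t2]; rewrite -[F2 t]opprK; apply/der_opp/D1; lra.
  by move=> t /andP[t1 t2]; apply: F2_ge0; lra.
pose m x := F0 (c + x) + F1 c * x.
have : m 0 <= m h.
  apply: (der_ge0_le (g := fun x => - F1 (c + x) + F1 c * 1)) => //.
    move=> x /andP[x0 xh].
    have d0 : der (fun t => F0 (c + t)) x (- F1 (c + x)).
      by apply/der_shift/D0; lra.
    exact: der_add d0 (der_linear (F1 c) x).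
  by move=> x /anti; lra.
by rewrite /m addr0 mulr0; lra.
Qed.

(** As [F3] decreases, [F2 (c + x) + F2 (c - x)] increases in [x >= 0] and stays above [2 * F2 c].
    Two integrations from the centre give the claim, the odd-order terms cancelling. *)
Lemma symmetric_taylor c h : 0 <= h -> lo <= c - h -> c + h <= hi ->
  (forall x, lo <= x <= hi -> 0 <= F4 x) ->
  2 * F0 c + h ^+ 2 * F2 c <= F0 (c + h) + F0 (c - h).
Proof.
move=> h0 lc hc F4_ge0.
have anti x : 0 <= x <= h -> F3 (c + x) <= F3 (c - x).
  move=> /andP[x0 xh]; rewrite -lerN2.
  apply: (der_ge0_le (f := fun t => - F3 t) (g := F4)); first by lra.
    move=> t /andP[t1 t2]; rewrite -[F4 t]opprK; apply/der_opp/D3; lra.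
  by move=> t /andP[t1 t2]; apply: F4_ge0; lra.
have shift (F G : R -> R) x : (forall z, lo <= z <= hi -> der F z (- G z)) ->
    0 <= x <= h -> der (fun t => F (c + t)) x (- G (c + x)).
  by move=> DF /andP[x0 xh]; apply/der_shift/DF; lra.
have refl (F G : R -> R) x : (forall z, lo <= z <= hi -> der F z (- G z)) ->
    0 <= x <= h -> der (fun t => F (c - t)) x (G (c - x)).
  by move=> DF /andP[x0 xh]; rewrite -[G _]opprK; apply/der_refl/DF; lra.
pose k2 x := F2 (c + x) + F2 (c - x).
have le2 x : 0 <= x <= h -> k2 0 <= k2 x.
  move=> /andP[x0 xh].
  apply: (der_ge0_le (g := fun x => - F3 (c + x) + F3 (c - x))) => //.
    move=> t /andP[t0 tx]; have th : 0 <= t <= h by lra.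
    exact: der_add (shift _ _ _ D2 th) (refl _ _ _ D2 th).
  by move=> t /andP[t0 tx]; have := anti t; lra.
pose k1 x := - F1 (c + x) + F1 (c - x) - 2 * F2 c * x.
have le1 x : 0 <= x <= h -> k1 0 <= k1 x.
  move=> /andP[x0 xh].
  apply: (der_ge0_le (g := fun x => - - F2 (c + x) + F2 (c - x) - 2 * F2 c * 1)) => //.
    move=> t /andP[t0 tx]; have th : 0 <= t <= h by lra.
    exact: der_add (der_add (der_opp (shift _ _ _ D1 th)) (refl _ _ _ D1 th))
      (der_opp (der_linear (2 * F2 c) t)).
  move=> t /andP[t0 tx]; have := le2 t; rewrite /k2 addr0 subr0; lra.
pose k0 x := F0 (c + x) + F0 (c - x) - F2 c * (x * x).
have : k0 0 <= k0 h.
  apply: (der_ge0_le (g := fun x => - F1 (c + x) + F1 (c - x) -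
      F2 c * (1 * x + x * 1))) => //.
    move=> t th.
    exact: der_add (der_add (shift _ _ _ D0 th) (refl _ _ _ D0 th))
      (der_opp (der_scale (F2 c) (der_mul (der_id t) (der_id t)))).
  move=> t th; have := le1 t th; rewrite /k1 addr0 subr0 mulr0; lra.
by rewrite /k0 addr0 subr0 mulr0; lra.
Qed.

End Taylor.

End Derivatives.

(** * Complete monotonicity of the radial profile *)

Section ProfileDerivatives.
Variables (R : realType) (s : nat).
Implicit Types (f g : R -> R) (t : R).
Local Notation der f x a := (is_derive x (1 : R) f a).

(** The variable is [t = r^2]: index 0 gives [r^-2] and not [r^-1], while [k > 0] gives
    [1 / log_k r]. *)
Definition recip (k : nat) t : R :=
  if k is 0%N then t^-1 else (iterlog k (Num.sqrt t))^-1.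

(** The derivative of [log_(k+1) (sqrt t)]; the factor 1/2 comes from the square root. *)
Definition weight (k : nat) t : R := 2^-1 * \prod_(0 <= i < k.+1) recip i t.

Local Notation dom := (fun t => large s (Num.sqrt t)).

(* Polynomials with nonnegative coefficients in the functions [recip k]. The
   class is closed under minus differentiation, so its elements are completely
   monotone. *)
Inductive recip_poly : (R -> R) -> Prop :=
| RPcst c : 0 <= c -> recip_poly (fun=> c)
| RPvar k : (k <= s)%N -> recip_poly (recip k)
| RPadd f g : recip_poly f -> recip_poly g -> recip_poly (fun t => f t + g t)
| RPmul f g : recip_poly f -> recip_poly g -> recip_poly (fun t => f t * g t).

Lemma dom_ge1 t : dom t -> 1 <= t.
Proof.
move=> dt; have t1 : 1 <= Num.sqrt t := dt 0%N (leq0n s).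
have t0 : 0 <= t.
  by rewrite leNgt; apply/negP => /ltW /ler0_sqrtr st; move: t1; rewrite st; lra.
by rewrite -(sqr_sqrtr t0) exprn_ege1.
Qed.

Lemma recip_itv k t : dom t -> (k <= s)%N -> 0 < recip k t <= 1.
Proof.
move=> dt ks; have t1 := dom_ge1 dt; case: k ks => [|k] ks /=.
  have t0 : 0 < t by exact: lt_le_trans t1.
  by rewrite invr_gt0 t0 invf_le1.
have k1 := dt _ ks; have k0 := large_gt0 dt ks.
by rewrite invr_gt0 k0 invf_le1.
Qed.

Lemma recip_poly_bound f : recip_poly f ->
  exists K, 0 <= K /\ forall t, dom t -> 0 <= f t <= K.
Proof.
elim=> [c c0|k ks|{}f g _ [K [K0 HK]] _ [L [L0 HL]]|{}f g _ [K [K0 HK]] _ [L [L0 HL]]].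
- by exists c; split=> // t _; rewrite c0 lexx.
- exists 1; split=> // t dt; have /andP[r0 ->] := recip_itv dt ks.
  by rewrite ltW.
- exists (K + L); split; first by rewrite addr_ge0.
  move=> t dt; have /andP[f0 fK] := HK t dt; have /andP[g0 gL] := HL t dt.
  by rewrite addr_ge0 ?lerD.
- exists (K * L); split; first by rewrite mulr_ge0.
  move=> t dt; have /andP[f0 fK] := HK t dt; have /andP[g0 gL] := HL t dt.
  by rewrite mulr_ge0 ?ler_pM.
Qed.

Lemma recip_poly_ge0 f t : recip_poly f -> dom t -> 0 <= f t.
Proof. by move=> /recip_poly_bound [K [_ HK]] /HK /andP[]. Qed.

Lemma recip_poly_prod m k : (k <= s.+1)%N ->
  recip_poly (fun t => \prod_(m <= i < k) recip i t).
Proof.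
elim: k => [|k IH] ks.
  rewrite (_ : (fun _ => _) = fun=> 1); first exact: RPcst.
  by apply/funext => t; rewrite big_geq.
have [mk|km] := leqP m k; last first.
  rewrite (_ : (fun _ => _) = fun=> 1); first exact: RPcst.
  by apply/funext => t; rewrite big_geq.
rewrite (_ : (fun _ => _) = fun t => (\prod_(m <= i < k) recip i t) * recip k t).
  by apply: RPmul; [apply: IH; exact: ltnW|exact: RPvar].
by apply/funext => t; rewrite big_nat_recr.
Qed.

Lemma recip_poly_weight k : (k <= s)%N -> recip_poly (weight k).
Proof.
by move=> ks; apply: RPmul; [apply: RPcst|exact: recip_poly_prod].
Qed.

Lemma recip_poly_sum m k (F : nat -> R -> R) :
  (forall i, (i < k)%N -> recip_poly (F i)) ->
  recip_poly (fun t => \sum_(m <= i < k) F i t).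
Proof.
elim: k => [|k IH] HF.
  rewrite (_ : (fun _ => _) = fun=> 0); first exact: RPcst.
  by apply/funext => t; rewrite big_geq.
have [mk|km] := leqP m k; last first.
  rewrite (_ : (fun _ => _) = fun=> 0); first exact: RPcst.
  by apply/funext => t; rewrite big_geq.
rewrite (_ : (fun _ => _) = fun t => (\sum_(m <= i < k) F i t) + F k t).
  by apply: RPadd; [apply: IH => i ik; apply: HF; exact: ltnW|exact: HF].
by apply/funext => t; rewrite big_nat_recr.
Qed.

Lemma ln_sqrt t : ln (Num.sqrt t) = 2^-1 * ln t.
Proof.
have [t0|t0] := leP 0 t; first by rewrite -powR12_sqrt // ln_powR.
by rewrite ler0_sqrtr ?ltW // !ln0 ?mulr0 // ltW.
Qed.

Lemma der_iterlog k t : dom t -> (k <= s)%N ->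
  der (fun t => iterlog k.+1 (Num.sqrt t)) t (weight k t).
Proof.
move=> dt; have t1 := dom_ge1 dt; have t0 : 0 < t by exact: lt_le_trans t1.
elim: k => [|k IH] ks.
  rewrite (_ : (fun _ => _) = fun t => 2^-1 * ln t).
    rewrite /weight big_nat1 /= -[t^-1]mul1r.
    exact: der_scale (@der_ln _ id t 1 t0 (der_id t)).
  by apply/funext => x; rewrite iterlogS ln_sqrt.
have lk : 0 < iterlog k.+1 (Num.sqrt t) := large_gt0 dt ks.
have := @der_ln _ (fun x => iterlog k.+1 (Num.sqrt x)) t _ lk (IH (ltnW ks)).
by rewrite /weight (@big_nat_recr _ _ _ k.+1) //= mulrA.
Qed.

Lemma der_recip k t : dom t -> (k <= s)%N ->
  der (recip k) t (- ((if k is 0%N then t^-1 else weight k t) * recip k t)).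
Proof.
move=> dt; have t1 := dom_ge1 dt; have t0 : 0 < t by exact: lt_le_trans t1.
case: k => [|k] ks.
  apply: is_derive_eq (@der_inv _ id t 1 (lt0r_neq0 t0) (der_id t)) _.
  by rewrite mul1r.
have lk : iterlog k.+1 (Num.sqrt t) != 0 by rewrite gt_eqF // (large_gt0 dt).
have := @der_inv _ (fun x => iterlog k.+1 (Num.sqrt x)) t _ lk
  (der_iterlog dt (ltnW ks)).
by rewrite /weight (@big_nat_recr _ _ _ k.+1) //= mulrA.
Qed.

Lemma weight_le k t : dom t -> (k <= s)%N -> weight k t <= t^-1.
Proof.
move=> dt ks; have t1 := dom_ge1 dt; have t0 : 0 < t by exact: lt_le_trans t1.
rewrite /weight big_nat_recl //= mulrCA ler_piMr ?invr_ge0 ?ltW //.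
have : \prod_(0 <= i < k) recip i.+1 t <= 1.
  rewrite big_nat; apply: prodr_ile1 => i /andP[_ ik].
  by have /andP[/ltW ->] := recip_itv dt (leq_trans ik ks).
by lra.
Qed.

(** The last clause says that differentiation gains a factor of order [1/t]. It holds for the
    generators and passes to sums and products because all terms are nonnegative; it is what
    controls the third derivative of the profile. *)
Lemma recip_poly_der f : recip_poly f -> exists g, [/\ recip_poly g,
  forall t, dom t -> der f t (- g t) &
  exists K, 0 <= K /\ forall t, dom t -> g t <= K * t^-1 * f t].
Proof.
elim=> [c c0|k ks|{}f g Pf [f' [Pf' df [K [K0 HK]]]] Pg [g' [Pg' dg [L [L0 HL]]]]
  |{}f g Pf [f' [Pf' df [K [K0 HK]]]] Pg [g' [Pg' dg [L [L0 HL]]]]].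
- exists (fun=> 0); split; first exact: RPcst.
    by move=> t _; rewrite oppr0; exact: der_cst.
  by exists 0; split=> // t _; rewrite !mul0r.
- exists (fun t => (if k is 0%N then recip 0 t else weight k t) * recip k t); split.
  + case: k ks => [|k] ks; first by apply: RPmul; exact: RPvar.
    by apply: RPmul; [exact: recip_poly_weight|exact: RPvar].
  + by move=> t dt; have := der_recip dt ks; case: k ks.
  exists 1; split=> // t dt; have /andP[/ltW r0 _] := recip_itv dt ks.
  rewrite mul1r ler_wpM2r //; case: k ks r0 => // k ks _.
  exact: weight_le.
- exists (fun t => f' t + g' t); split; first exact: RPadd.
    by move=> t dt; rewrite opprD; apply: der_add; [exact: df|exact: dg].
  exists (K + L); split; first by rewrite addr_ge0.
  move=> t dt; have := HK t dt; have := HL t dt.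
  have f0 := recip_poly_ge0 Pf dt; have g0 := recip_poly_ge0 Pg dt.
  have ti : 0 <= t^-1 by rewrite invr_ge0 (le_trans _ (dom_ge1 dt)).
  have := mulr_ge0 (mulr_ge0 K0 ti) g0; have := mulr_ge0 (mulr_ge0 L0 ti) f0.
  by lra.
- exists (fun t => f' t * g t + f t * g' t); split.
  + by apply: RPadd; apply: RPmul.
  + move=> t dt; rewrite opprD -mulNr -mulrN.
    by apply: der_mul; [exact: df|exact: dg].
  exists (K + L); split; first by rewrite addr_ge0.
  move=> t dt.
  have f0 := recip_poly_ge0 Pf dt; have g0 := recip_poly_ge0 Pg dt.
  have := ler_wpM2r g0 (HK t dt); have := ler_wpM2l f0 (HL t dt).
  by lra.
Qed.

Variable d : nat.

(** The logarithmic sum of the explicit criterion at [r = sqrt t]. *)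
Definition logsum t : R := \sum_(1 <= j < s.+1) \prod_(1 <= k < j.+1) recip k t.

Lemma recip_poly_logsum : recip_poly logsum.
Proof.
by apply: recip_poly_sum => i is_; apply: recip_poly_prod.
Qed.

Definition radial t : R := profile d s (Num.sqrt t).

Lemma der_radial t : dom t ->
  der radial t (- (radial t * (t^-1 * (4^-1 * (d%:R + logsum t))))).
Proof.
move=> dt; rewrite -mulrN; apply: der_exp; apply: der_opp.
have -> : t^-1 * (4^-1 * (d%:R + logsum t)) =
    d%:R / 2 * weight 0 t + 2^-1 * \sum_(1 <= i < s.+1) weight i t.
  rewrite /logsum /weight big_nat1 -mulr_sumr.
  have -> : \sum_(1 <= i < s.+1) \prod_(0 <= j < i.+1) recip j t =
      t^-1 * \sum_(1 <= i < s.+1) \prod_(1 <= j < i.+1) recip j t.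
    rewrite mulr_sumr; apply: eq_bigr => i _.
    by rewrite big_nat_recl //= big_add1.
  by rewrite /=; field; rewrite gt_eqF // (lt_le_trans _ (dom_ge1 dt)).
apply: der_add; apply: der_scale; first exact: der_iterlog.
apply: der_sum => i; rewrite mem_index_iota => /andP[_ is_].
exact: der_iterlog.
Qed.

Lemma der_radial_mul (p q : R -> R) t : dom t -> der p t (- q t) ->
  der (fun x => radial x * p x) t
    (- (radial t * (t^-1 * (4^-1 * (d%:R + logsum t)) * p t + q t))).
Proof.
move=> dt dp; apply: is_derive_eq (der_mul (der_radial dt) dp) _; ring.
Qed.

(** Minus differentiation sends [radial * p] to [radial * (P * p + p')], where [P] is minus the
    logarithmic derivative of [radial] and [p'] minus the derivative of [p]; both factors stay in
    the class. The lower bound for [F2] discards the nonnegative term with [h']. *)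
Lemma radial_derivatives : exists F1 F2 F3 F4 : R -> R,
  [/\ forall t, dom t -> der radial t (- F1 t),
      forall t, dom t -> der F1 t (- F2 t),
      forall t, dom t -> der F2 t (- F3 t) &
      forall t, dom t -> der F3 t (- F4 t)] /\
  [/\ forall t, dom t -> 0 <= F2 t /\ 0 <= F4 t,
      forall t, dom t -> F1 t = radial t * (t^-1 * (4^-1 * (d%:R + logsum t))),
      forall t, dom t -> radial t * (t^-1 ^+ 2 *
        (16^-1 * (d%:R + logsum t) ^+ 2 + 4^-1 * (d%:R + logsum t))) <= F2 t &
      exists2 C, 0 <= C & forall t, dom t -> F3 t <= C * t^-1 ^+ 3 * radial t].
Proof.
pose h t := 4^-1 * (d%:R + logsum t).
have Ph : recip_poly h.
  by apply: RPmul; [exact: RPcst|apply: RPadd; [exact: RPcst|exact: recip_poly_logsum]].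
pose y := recip 0; have Py : recip_poly y by exact: RPvar.
have [h' [Ph' dh [K [K0 HK]]]] := recip_poly_der Ph.
pose P t := y t * h t; have PP : recip_poly P by exact: RPmul.
pose P' t := y t * y t * h t + y t * h' t.
have PP' : recip_poly P' by apply: RPadd; apply: RPmul => //; exact: RPmul.
have dP t : dom t -> der P t (- P' t).
  move=> dt; have dy : der y t (- (t^-1 * t^-1)) := der_recip dt (leq0n s).
  apply: is_derive_eq (der_mul dy (dh t dt)) _.
  by rewrite /P' /y /=; ring.
pose p2 t := P t * P t + P' t.
have Pp2 : recip_poly p2 by apply: RPadd => //; exact: RPmul.
have [p2' [Pp2' dp2 [K2 [K20 HK2]]]] := recip_poly_der Pp2.
pose p3 t := P t * p2 t + p2' t.
have Pp3 : recip_poly p3 by apply: RPadd => //; exact: RPmul.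
have [p3' [Pp3' dp3 _]] := recip_poly_der Pp3.
have [B [B0 HB]] := recip_poly_bound Ph.
exists (fun t => radial t * P t), (fun t => radial t * p2 t),
  (fun t => radial t * p3 t), (fun t => radial t * (P t * p3 t + p3' t)).
have rad0 t : 0 <= radial t by rewrite ltW // profile_gt0.
split; split.
- by move=> t dt; exact: der_radial.
- by move=> t dt; apply: der_radial_mul => //; exact: dP.
- by move=> t dt; apply: der_radial_mul => //; exact: dp2.
- by move=> t dt; apply: der_radial_mul => //; exact: dp3.
- move=> t dt; split; first by rewrite mulr_ge0 // recip_poly_ge0.
  rewrite mulr_ge0 //; apply: (@recip_poly_ge0 (fun t => P t * p3 t + p3' t)) => //.
  by apply: RPadd => //; exact: RPmul.
- by [].
- move=> t dt; rewrite ler_wpM2l //.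
  have h'0 := recip_poly_ge0 Ph' dt; have y0 := recip_poly_ge0 Py dt.
  rewrite /p2 /P' /P -/(recip 0 t) -/(y t) -subr_ge0.
  have := mulr_ge0 y0 h'0; rewrite /h; lra.
exists ((B + K2) * (B * B + B + K * B)).
  by rewrite mulr_ge0 ?addr_ge0 // mulr_ge0.
move=> t dt; rewrite mulrC ler_wpM2r //.
have y0 := recip_poly_ge0 Py dt; have /andP[h0 hB] := HB t dt.
have h'K := HK t dt; have p2K := HK2 t dt; have p20 := recip_poly_ge0 Pp2 dt.
rewrite -/(recip 0 t) -/(y t) in h'K p2K *.
have p2B : p2 t <= (B * B + B + K * B) * y t ^+ 2.
  have e1 : h t * h t <= B * B by rewrite ler_pM.
  have e2 : y t * h' t <= y t * (K * y t * B).
    rewrite ler_wpM2l // (le_trans h'K) // ler_wpM2l // mulr_ge0 //.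
  have yy : 0 <= y t * y t by rewrite mulr_ge0.
  have := ler_wpM2l yy e1; have := ler_wpM2l yy hB.
  by rewrite /p2 /P' /P expr2; lra.
have : p3 t <= (B + K2) * y t * p2 t.
  have := ler_wpM2r p20 (ler_wpM2l y0 hB).
  by rewrite /p3 /P; lra.
move=> /le_trans; apply.
have BKy : 0 <= (B + K2) * y t by rewrite mulr_ge0 // addr_ge0.
have := ler_wpM2l BKy p2B; lra.
Qed.

End ProfileDerivatives.

(** * The two criteria *)

Section GroundStates.
Variables (R : realType) (d' s : nat).
Local Notation d := d'.+1.
Local Notation Z := 'rV[int]_d.
Implicit Types (n : Z) (V : Z -> R).

Definition radial_profile n : R := profile d s (enorm R n).

Lemma no_ground_state V :
  (exists r, forall n, r <= enorm R n -> V n * radial_profile n <=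
    nbsum radial_profile n - 2 * d%:R * radial_profile n) ->
  no_zero_energy_ground_state V.
Proof.
move=> [r Hr]; have [ps|] := pselect
  (point_spectrum (mulop_dom V) (schrodinger V) 0); last by left.
right=> inf0.
have [f [n0 [df fn0 Hf]]] := real_eigenfunction ps.
have [phi [sphi phi0 Hphi]] :=
  positive_ground_state (rham_form_ge0 inf0) df fn0 Hf.
have [r0 _ Hr0] := eventually_large R s.
have [|||c c0 Hc] := @supersolution_lower_bound R d V phi radial_profile
  (Num.max r r0) phi0 Hphi.
- by move=> n; exact: profile_gt0.
- by move=> n; rewrite ge_max => /andP[/Hr].
- by move=> n; rewrite ge_max => /andP[_ /Hr0]; exact: profile_decay.
apply: (@profile_not_sqsum R d' s).
apply: sqsum_le (sqsumZ c^-1 sphi) _ => n.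
rewrite !gtr0_norm ?mulr_gt0 ?invr_gt0 ?profile_gt0 //.
by rewrite ler_pdivlMl //; exact: Hc.
Qed.

Lemma enorm_step_ge n p r : r + 1 <= enorm R n -> r <= enorm R (n + unit_step p).
Proof.
by have := enorm_step R n p; rewrite ler_norml => /andP[h1 h2] h3; lra.
Qed.

Lemma profile_ratio_criterion V :
  for_large_norm R (fun n => V n <= - (2 * d%:R) +
    \sum_(j < d)
      ((enorm R n / enorm R (n + delta j)) `^ (d%:R / 2) *
         \prod_(1 <= i < s.+1)
           Num.sqrt (iterlog i (enorm R n) / iterlog i (enorm R (n + delta j)))
       + (enorm R n / enorm R (n - delta j)) `^ (d%:R / 2) *
         \prod_(1 <= i < s.+1)
           Num.sqrt (iterlog i (enorm R n) / iterlog i (enorm R (n - delta j))))) ->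
  no_zero_energy_ground_state V.
Proof.
move=> [r Hr]; apply: no_ground_state.
have [r0 _ Hr0] := eventually_large R s.
exists (Num.max r (r0 + 1)) => n; rewrite ge_max => /andP[/Hr Vn nr].
have u0 : 0 < radial_profile n by exact: profile_gt0.
have := ler_wpM2r (ltW u0) Vn; rewrite mulrDl mulr_suml.
have -> : nbsum radial_profile n = \sum_(j < d)
      ((enorm R n / enorm R (n + delta j)) `^ (d%:R / 2) *
         \prod_(1 <= i < s.+1)
           Num.sqrt (iterlog i (enorm R n) / iterlog i (enorm R (n + delta j)))
       + (enorm R n / enorm R (n - delta j)) `^ (d%:R / 2) *
         \prod_(1 <= i < s.+1)
           Num.sqrt (iterlog i (enorm R n) / iterlog i (enorm R (n - delta j))))
    * radial_profile n; last by lra.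
have ln : large s (enorm R n) by apply: Hr0; lra.
have ratioE m : large s (enorm R m) -> radial_profile m =
    (enorm R n / enorm R m) `^ (d%:R / 2) *
      \prod_(1 <= i < s.+1)
        Num.sqrt (iterlog i (enorm R n) / iterlog i (enorm R m)) *
    radial_profile n.
  by move=> lm; rewrite (profile_ratio d ln lm) divfK // gt_eqF.
apply: eq_bigr => j _; rewrite mulrDl; congr (_ + _); apply: ratioE.
  exact: Hr0 _ (enorm_step_ge (j, true) nr).
exact: Hr0 _ (enorm_step_ge (j, false) nr).
Qed.

End GroundStates.

(** * The explicit criterion by expansion in the squared norm *)

Section LogarithmicCriterion.
Variables (R : realType) (d' s : nat).
Local Notation d := d'.+1.
Local Notation Z := 'rV[int]_d.
Implicit Types (n : Z) (V : Z -> R).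

(** Apply [ln y < y] at [y = sqrt x]. It serves to compare [1 / (ln r)^2] with the error of order
    [r^-2]. *)
Lemma ln_sqr_le (x : R) : 1 <= x -> ln x ^+ 2 <= 4 * x.
Proof.
move=> x1; have x0 : 0 < x by lra.
have sx : 0 < Num.sqrt x by rewrite sqrtr_gt0.
have lns : ln (Num.sqrt x) <= Num.sqrt x by rewrite ltW // ln_sublinear.
have lx0 := ln_ge0 x1.
have -> : 4 * x = (2 * Num.sqrt x) ^+ 2 by rewrite exprMn sqr_sqrtr ?ltW //; ring.
rewrite lerXn2r ?nnegrE ?mulr_ge0 ?sqrtr_ge0 //.
by move: lns; rewrite {1}ln_sqrt; lra.
Qed.

Lemma radial_subsolution : exists r : R, forall n, r <= enorm R n ->
  (d%:R * (4 - d%:R) / (4 * enorm R n ^+ 2) + (enorm R n ^+ 2)^-1 *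
    \sum_(1 <= j < s.+1) \prod_(1 <= k < j.+1) (iterlog k (enorm R n))^-1) *
  radial_profile R s.+1 n <=
  nbsum (@radial_profile R d' s.+1) n - 2 * d%:R * radial_profile R s.+1 n.
Proof.
have [F1 [F2 [F3 [F4 [[D0 D1 D2 D3] [pos F1E F2ge [C C0 F3le]]]]]]] :=
  radial_derivatives R s.+1 d.
have [r0 r01 Hr0] := eventually_large R s.+1.
(* [r0 + 1] keeps the neighbours in the range of large logarithms; [64 * C] is what
   [4 C / r^2 <= 1 / (16 r)] requires. *)
exists (Num.max (r0 + 1) (64 * C)) => n.
rewrite ge_max; set r := enorm R n => /andP[rr0 rC].
have r2 : 2 <= r by lra.
pose F := radial (R := R) s.+1 d; pose t := r ^+ 2.
have uE (m : Z) : radial_profile R s.+1 m = F (enorm R m ^+ 2).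
  by rewrite /F /radial sqrtr_sqr ger0_norm ?enorm_ge0.
(* As each coordinate is at most [r] in absolute value, the squared norms of all neighbours lie in
   this interval. *)
pose lo := (r - 1) ^+ 2; pose hi := (r + 1) ^+ 2.
have dom x : lo <= x <= hi -> large s.+1 (Num.sqrt x).
  move=> /andP[lx _]; apply: Hr0; apply: le_trans (_ : r - 1 <= _); first by lra.
  rewrite -[leLHS]ger0_norm ?subr_ge0; last by lra.
  by rewrite -sqrtr_sqr ler_wsqrtr.
have onI (P : R -> Prop) : (forall x, large s.+1 (Num.sqrt x) -> P x) ->
    forall x, lo <= x <= hi -> P x by move=> HP x /dom; exact: HP.
have F2_ge0 := onI _ (fun x dx => proj1 (pos x dx)).
have F4_ge0 := onI _ (fun x dx => proj2 (pos x dx)).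
have d0 := onI _ D0; have d1 := onI _ D1; have d2 := onI _ D2; have d3 := onI _ D3.
have lot : lo <= t by rewrite /lo /t; nra.
have thi : t + 1 <= hi by rewrite /hi /t; nra.
have dt : large s.+1 (Num.sqrt t) by apply: dom; rewrite lot /=; lra.
have tay (j : 'I_d) : 2 * F (t + 1) + 4 * (n ord0 j)%:~R ^+ 2 * F2 (t + 1) <=
    radial_profile R s.+1 (n + delta j) + radial_profile R s.+1 (n - delta j).
  rewrite !uE (enorm_step_sqr R n (j, true)) (enorm_step_sqr R n (j, false)) /=.
  have := coord_le_enorm R n j; rewrite -/r; set x := _%:~R => xr.
  have taylor h : 0 <= h -> h <= r ->
      2 * F (t + 1) + (2 * h) ^+ 2 * F2 (t + 1) <=
      F (t + 1 + 2 * h) + F (t + 1 - 2 * h).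
    move=> h0 hr; apply: (symmetric_taylor d0 d1 d2 d3) => //.
    - by rewrite mulr_ge0.
    - by rewrite /lo /t; lra.
    - by rewrite /hi /t; lra.
  have := taylor `|x| (normr_ge0 x) xr.
  have -> : (2 * `|x|) ^+ 2 = 4 * x ^+ 2.
    by rewrite exprMn real_normK ?num_real //; ring.
  rewrite -/t [t + 1 * 2 * x + 1](_ : _ = t + 1 + 2 * x); last by ring.
  rewrite [t + - 1 * 2 * x + 1](_ : _ = t + 1 - 2 * x); last by ring.
  have [x0|x0] := ger0P x; first by lra.
  by rewrite !mulrN opprK; lra.
have sum_tay : 2 * d%:R * F (t + 1) + 4 * t * F2 (t + 1) <=
    nbsum (@radial_profile R d' s.+1) n.
  apply: le_trans (ler_sum _ (fun j _ => tay j)).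
  rewrite big_split /= sumr_const card_ord -[X in _ <= X + _]mulr_natl.
  have -> : \sum_(j < d) 4 * (n ord0 j)%:~R ^+ 2 * F2 (t + 1) =
      4 * t * F2 (t + 1).
    by rewrite -mulr_suml -mulr_sumr -enorm_sqr.
  by lra.
have tan0 : F t - 1 * F1 t <= F (t + 1).
  by apply: (tangent_below d0 d1).
have tan2 : F2 t - 1 * F3 t <= F2 (t + 1).
  by apply: (tangent_below d2 d3).
have Ft : 0 < F t by exact: profile_gt0.
pose y := t^-1; pose T := logsum s.+1 t; pose q := d%:R + T.
have t0 : 0 < t by rewrite exprn_gt0 //; lra.
have ty : t * y = 1 by rewrite divff // gt_eqF.
have y0 : 0 < y by rewrite invr_gt0.
have F1t : F1 t = F t * (y * (4^-1 * q)) by exact: F1E.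
have F2t : F t * (y ^+ 2 * (16^-1 * q ^+ 2 + 4^-1 * q)) <= F2 t by exact: F2ge.
have F3t : F3 t <= C * y ^+ 3 * F t by exact: F3le.
(* The terms without [C] are [- d q / 2 + q^2 / 4 + q] for [q = d + T]: the products [d T] cancel,
   and [T^2 / 4] is left to absorb the error [4 C y] from [F3]. *)
have main : F t * y * (d%:R - d%:R ^+ 2 / 4 + T + T ^+ 2 / 4 - 4 * C * y) <=
    nbsum (@radial_profile R d' s.+1) n - 2 * d%:R * F t.
  have dd0 : 0 <= 2 * d%:R :> R by rewrite mulr_ge0.
  have tt0 : 0 <= 4 * t by rewrite mulr_ge0 // ltW.
  have e1 := ler_wpM2l dd0 tan0; have e2 := ler_wpM2l tt0 tan2.
  have e3 := ler_wpM2l tt0 F2t; have e4 := ler_wpM2l tt0 F3t.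
  have E3 : 4 * t * (F t * (y ^+ 2 * (16^-1 * q ^+ 2 + 4^-1 * q))) =
    F t * y * (q ^+ 2 / 4 + q).
    transitivity ((t * y) * (F t * y * (q ^+ 2 / 4 + q))); first by field.
    by rewrite ty mul1r.
  have E4 : 4 * t * (C * y ^+ 3 * F t) = F t * y * (4 * C * y).
    transitivity ((t * y) * (F t * y * (4 * C * y))); first by ring.
    by rewrite ty mul1r.
  have E1 : 2 * d%:R * (F t - 1 * F1 t) =
      2 * d%:R * F t - F t * y * (d%:R * q / 2).
    by rewrite F1t; field.
  rewrite E1 in e1; rewrite E3 in e3; rewrite E4 in e4.
  have -> : F t * y * (d%:R - d%:R ^+ 2 / 4 + T + T ^+ 2 / 4 - 4 * C * y) =
     - (F t * y * (d%:R * q / 2)) + F t * y * (q ^+ 2 / 4 + q) -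
     F t * y * (4 * C * y).
    by rewrite /q; field.
  by lra.
rewrite uE -/r -/t.
apply: le_trans main.
have -> : d%:R * (4 - d%:R) / (4 * t) = y * (d%:R - d%:R ^+ 2 / 4).
  by rewrite /y; field; rewrite gt_eqF.
have sqt : Num.sqrt t = r by rewrite /t sqrtr_sqr ger0_norm //; lra.
set Ts := \sum_(1 <= j < s.+1) _.
have logprod j : \prod_(1 <= k < j) recip k t = \prod_(1 <= k < j) (iterlog k r)^-1.
  by apply: eq_big_nat => -[] // k _; rewrite /= sqt.
have prod_gt0 j : (j < s.+2)%N -> 0 < \prod_(1 <= k < j.+1) recip k t.
  move=> js; rewrite big_nat; apply: prodr_gt0 => k /andP[_ kj].
  have ks : (k <= s.+1)%N by exact: leq_trans kj js.
  by have /andP[] := recip_itv dt ks.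
have TsT : Ts <= T.
  rewrite /T /logsum big_nat_recr //= -[leLHS]addr0; apply: lerD.
    by rewrite le_eqVlt; apply/orP; left; apply/eqP; apply: eq_bigr => j _.
  exact/ltW/prod_gt0.
(* The profile carries [s + 1] logarithms, so this term is present even for [s = 0]. *)
have T1 : (ln r)^-1 <= T.
  rewrite /T /logsum big_ltn // big_nat1 /= sqt -[leLHS]addr0 lerD //.
  rewrite big_nat; apply: sumr_ge0 => j /andP[_ js].
  exact/ltW/prod_gt0.
have lnr : 0 < ln r by rewrite ln_gt0 //; lra.
have Ty : 4 * C * y <= T ^+ 2 / 4.
  apply: (@le_trans _ _ ((ln r)^-1 ^+ 2 / 4)); last first.
    by rewrite ler_wpM2r ?invr_ge0 // lerXn2r ?nnegrE ?invr_ge0 ?(ltW lnr) //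
      (le_trans _ T1) // invr_ge0 ltW.
  have r0' : 0 < r by lra.
  apply: (@le_trans _ _ ((4 * r)^-1 / 4)); last first.
    rewrite ler_wpM2r ?invr_ge0 // exprVn lef_pV2 ?posrE ?exprn_gt0 ?mulr_gt0 //.
    by apply: ln_sqr_le; lra.
  have -> : (4 * r)^-1 / 4 = r / 16 * y by rewrite /y /t; field; rewrite gt_eqF.
  by rewrite ler_wpM2r ?(ltW y0) //; lra.
have Fy : 0 <= F t * y by rewrite mulr_ge0 // ltW.
have : 0 <= F t * y * ((T - Ts) + (T ^+ 2 / 4 - 4 * C * y)).
  by rewrite mulr_ge0 // addr_ge0 // subr_ge0.
by rewrite -/y; lra.
Qed.

Lemma logarithmic_criterion V :
  for_large_norm R (fun n => V n <= d%:R * (4 - d%:R) / (4 * enorm R n ^+ 2) +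
    (enorm R n ^+ 2)^-1 * \sum_(1 <= j < s.+1) \prod_(1 <= k < j.+1)
      (iterlog k (enorm R n))^-1) ->
  no_zero_energy_ground_state V.
Proof.
move=> [r Hr]; have [r1 Hr1] := radial_subsolution.
apply: (@no_ground_state R d' s.+1); exists (Num.max r r1) => n.
rewrite ge_max => /andP[/Hr Vn /Hr1]; apply: le_trans.
by rewrite ler_wpM2r // ltW // profile_gt0.
Qed.

End LogarithmicCriterion.

Theorem theorem15 (R : realType) (d : nat) (hd : (0 < d)%N)
    (V : 'rV[int]_d -> R) :
  ((exists s : nat, for_large_norm R (fun n : 'rV[int]_d =>
      V n <= - (2 * d%:R) +
        \sum_(j < d)
          ((enorm R n / enorm R (n + delta j)) `^ (d%:R / 2) *
             \prod_(1 <= i < s.+1)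
               Num.sqrt (iterlog i (enorm R n) /
                         iterlog i (enorm R (n + delta j)))
           + (enorm R n / enorm R (n - delta j)) `^ (d%:R / 2) *
             \prod_(1 <= i < s.+1)
               Num.sqrt (iterlog i (enorm R n) /
                         iterlog i (enorm R (n - delta j))))))
   -> no_zero_energy_ground_state V)
  /\
  ((exists s : nat, for_large_norm R (fun n : 'rV[int]_d =>
      V n <= d%:R * (4 - d%:R) / (4 * enorm R n ^+ 2) +
        (enorm R n ^+ 2)^-1 *
          \sum_(1 <= j < s.+1) \prod_(1 <= k < j.+1)
             (iterlog k (enorm R n))^-1))
   -> no_zero_energy_ground_state V).
Proof.
case: d hd V => // d' _ V; split=> -[s]; first exact: profile_ratio_criterion.
exact: logarithmic_criterion.
Qed.
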